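(* Let $F:\mathbb{R}^p\to\mathbb{R}$, $F(\mathbf{x})=\mathbb{E}_{\boldsymbol\theta}[f(\mathbf{x},\boldsymbol\theta)]$, with minimizer $\mathbf{x}^*$, and let $\{\mathbf{x}^t\}_{t\ge 0}$ be the iterates of the random parallel stochastic algorithm (RAPSA) described in the context, with block ratio $r=I/B$ and constant stepsize $\gamma^t=\gamma>0$. Suppose that the instantaneous functions $f(\cdot,\boldsymbol\theta)$ are differentiable, that $F$ is strongly convex with parameter $m>0$, that $\nabla F$ is Lipschitz continuous with parameter $M$, and that $\mathbb{E}_{\boldsymbol\theta}\big[\|\nabla f(\mathbf{x}^t,\boldsymbol\theta)\|^2\mid \mathbf{x}^t\big]\le K$ for all $t\ge 0$. (i) Then $$\liminf_{t\to\infty}F(\mathbf{x}^t)-F(\mathbf{x}^* )\le\frac{\gamma MK}{4m}\quad\text{almost surely.}$$ (ii) If moreover $2mr\gamma<1$, then for all $t\ge0$ $$\mathbb{E}[F(\mathbf{x}^t)-F(\mathbf{x}^* )]\le(1-2m\gamma r)^t\big(F(\mathbf{x}^0)-F(\mathbf{x}^* )\big)+\frac{\gamma MK}{4m}.$$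
   Context: Setting. $\boldsymbol\theta$ is a random variable with values in $\boldsymbol\Theta\subset\mathbb{R}^q$, and for each $\boldsymbol\theta$ the instantaneous function $f(\cdot,\boldsymbol\theta):\mathbb{R}^p\to\mathbb{R}$ is differentiable. $F(\mathbf{x})=\mathbb{E}_{\boldsymbol\theta}[f(\mathbf{x},\boldsymbol\theta)]$ is differentiable, $\mathbf{x}^*=\arg\min F$, and stochastic gradients are unbiased: $\mathbb{E}_{\boldsymbol\theta}[\nabla f(\mathbf{x},\boldsymbol\theta)]=\nabla F(\mathbf{x})$. Strong convexity with parameter $m$ means $F(\mathbf{y})\ge F(\mathbf{z})+\nabla F(\mathbf{z})^T(\mathbf{y}-\mathbf{z})+\frac m2\|\mathbf{y}-\mathbf{z}\|^2$ for all $\mathbf{y},\mathbf{z}\in\mathbb{R}^p$. Lipschitz continuity of $\nabla F$ with parameter $M$ means $\|\nabla F(\mathbf{x})-\nabla F(\mathbf{y})\|\le M\|\mathbf{x}-\mathbf{y}\|$ (Euclidean norm). RAPSA. The variable is split into $B$ blocks, $\mathbf{x}=[\mathbf{x}_1;\dots;\mathbf{x}_B]$, $\mathbf{x}_b\in\mathbb{R}^{p_b}$. There are $I\le B$ processors and $r:=I/B$. The initial point $\mathbf{x}^0$ is deterministic. At each step $t\ge0$ a set $\mathcal{I}^t\subset\{1,\dots,B\}$ of $I$ distinct blocks is drawn uniformly at random among all subsets of size $I$. For each block $i$ a mini-batch $\boldsymbol\Theta_i^t$ of $L\ge1$ independent copies of $\boldsymbol\theta$ is drawn; the mini-batches are independent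 of each other, of $\mathcal{I}^t$ and of the past, and $\mathcal{I}^t$ is independent of the past. With $\nabla_{\mathbf{x}_i}f(\mathbf{x}^t,\boldsymbol\Theta_i^t)=\frac1L\sum_{\boldsymbol\theta\in\boldsymbol\Theta_i^t}\nabla_{\mathbf{x}_i}f(\mathbf{x}^t,\boldsymbol\theta)$, the update is $$\mathbf{x}_i^{t+1}=\mathbf{x}_i^t-\gamma^t\nabla_{\mathbf{x}_i}f(\mathbf{x}^t,\boldsymbol\Theta_i^t)\ \ (i\in\mathcal{I}^t),\qquad \mathbf{x}_i^{t+1}=\mathbf{x}_i^t\ \ (i\notin\mathcal{I}^t).$$ In the second-moment bound, $\boldsymbol\theta$ is a fresh copy independent of $\mathbf{x}^t$. The expectation $\mathbb{E}$ without conditioning is over all randomness of the algorithm. *)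

(* Defs.v *)
From HB Require Import structures.
From mathcomp Require Import all_boot all_order all_algebra.
From mathcomp Require Import all_classical all_reals all_analysis measurable_realfun.

Set Implicit Arguments.
Unset Strict Implicit.
Unset Printing Implicit Defensive.

Import Order.TTheory GRing.Theory Num.Theory.
Import numFieldNormedType.Exports.

Local Open Scope classical_set_scope.
Local Open Scope ring_scope.

Section Euclidean.
Context {R : realType} {n : nat}.
Implicit Types (x y z : 'rV[R]_n) (g : 'rV[R]_n -> R).

Definition dotp x y : R := \sum_(j < n) x 0 j * y 0 j.

(* The library norm `|x| on row vectors is the sup norm; it induces the same
   topology and the same notion of differentiability as enorm. *)
Definition enorm x : R := Num.sqrt (dotp x x).

(* Meaningful at points where g is differentiable. *)
Definition grad g x : 'rV[R]_n := \row_(j < n) 'D_(delta_mx 0 j) g x.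

Definition strongly_convex (m : R) g : Prop :=
  forall y z,
    g z + dotp (grad g z) (y - z) + m / 2 * enorm (y - z) ^+ 2 <= g y.

Definition lipschitz_gradient (M : R) g : Prop :=
  forall x y, enorm (grad g x - grad g y) <= M * enorm (x - y).

End Euclidean.

Section Probability.
Context {d : measure_display} {Omega : measurableType d} {R : realType}.
Variable P : probability Omega R.

Definition borel (V : topologicalType) : set (set V) := <<s @open V >>.

Definition sigma_of {V : topologicalType} (X : Omega -> V) : set (set Omega) :=
  preimage_set_system setT X (@borel V).

Definition borel_random {V : topologicalType} (X : Omega -> V) : Prop :=
  sigma_of X `<=` measurable.

Definition same_law {V : topologicalType} (X Y : Omega -> V) : Prop :=
  forall A, @borel V A -> P (X @^-1` A) = P (Y @^-1` A).

Definition independent2 (G H : set (set Omega)) : Prop :=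
  forall A C, G A -> H C -> P (A `&` C) = (P A * P C)%E.

Definition mutually_independent (J : choiceType)
    (G : J -> set (set Omega)) : Prop :=
  forall (s : seq J) (A : J -> set Omega), uniq s ->
    (forall j, j \in s -> G j (A j)) ->
    P (\big[setI/setT]_(j <- s) A j) = (\prod_(j <- s) P (A j))%E.

(* Y is a version of the conditional expectation of Z given the
   sigma-algebra G, for a measurable Z that is nonnegative or integrable. *)
Definition is_cond_exp (G : set (set Omega)) (Z Y : Omega -> \bar R) : Prop :=
  preimage_set_system setT Y (@measurable _ (\bar R)) `<=` G /\
  (forall A, G A -> \int[P]_(w in A) Y w = \int[P]_(w in A) Z w)%E.

(* The sigma-algebra on D is the trace of the Borel sets of V, so that D
   itself need not be a Borel set. *)
Definition borel_on {V : topologicalType} (D : set V) (g : V -> R) : Prop :=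
  preimage_set_system D g measurable `<=` preimage_set_system D id (@borel V).

End Probability.

Section Rapsa.
Context {R : realType} {B L q : nat} {Omega : Type} {pb : 'I_B -> nat}.
Local Notation Rp := 'rV[R]_(\sum_(b < B) pb b).
Variable f : Rp -> 'rV[R]_q -> R.

Definition batch_grad (x : Rp) (i : 'I_B) (batch : 'I_L -> 'rV[R]_q) :
    'rV[R]_(pb i) :=
  L%:R^-1 *: \sum_(l < L) submxrow (grad (f^~ (batch l)) x) i.

Fixpoint rapsa (gam : nat -> R) (x0 : Rp) (Is : nat -> Omega -> {set 'I_B})
    (xi : nat -> 'I_B -> 'I_L -> Omega -> 'rV[R]_q) (t : nat) (w : Omega) :
    Rp :=
  if t is s.+1 then
    let x := rapsa gam x0 Is xi s w in
    \mxrow_(i < B)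
      (if i \in Is s w
       then submxrow x i - gam s *: batch_grad x i (fun l => xi s i l w)
       else submxrow x i)
  else x0.

(* The sigma-algebras generated by all the random draws of the algorithm. *)
Definition draws (Is : nat -> Omega -> {set 'I_B})
    (xi : nat -> 'I_B -> 'I_L -> Omega -> 'rV[R]_q)
    (j : nat + nat * 'I_B * 'I_L) : set (set Omega) :=
  match j with
  | inl t => preimage_set_system setT (Is t) setT
  | inr (t, i, l) => preimage_set_system setT (xi t i l) (@borel 'rV[R]_q)
  end.

End Rapsa.

(* Main.v *)
Require Import Defs.
From HB Require Import structures.
From mathcomp Require Import all_boot all_order all_algebra.
From mathcomp Require Import all_classical all_reals all_analysis measurable_realfun.
From mathcomp Require Import ring lra.

Set Implicit Arguments.
Unset Strict Implicit.
Unset Printing Implicit Defensive.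

Import Order.TTheory GRing.Theory Num.Theory.
Import numFieldNormedType.Exports.

Local Open Scope classical_set_scope.
Local Open Scope ring_scope.

(* Write e_t = F(x^t) - min F, rho = 2 m gamma r and c = gamma M K / (4 m).
   For a fixed point x, the descent inequality for F, the unbiasedness of the
   block directions and the bound K on their second moment give
     E[F(x^{t+1}) | past] <= F(x^t) - gamma r |grad F(x^t)|^2
                             + M gamma^2 r K / 2,
   and |grad F|^2 >= 2 m (F - min F) by strong convexity. As x^t depends on the
   past draws only and those are independent of the draws of step t, Fubini's
   theorem turns this into
     E[e_{t+1}; A] <= (1 - rho) E[e_t; A] + rho c P(A)
   for every event A of the past up to time t. With A the sure event, induction
   gives (ii). For (i), apply it to A_k = {e_s > c + e for T <= s <= T + k}:
   each step then costs at least rho e P(A_k), so that the sum of the P(A_k) is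
   at most E[e_T] / (rho e), and the intersection of the A_k is null. *)

(** * Gradients, smoothness and strong convexity *)

(** No conditional expectation given the past is ever formed: a step is integrated over its own
    draws with the iterate frozen. The price is joint measurability of gradients at random points,
    which comes from differentiability in the point and measurability in the parameter.

    Working with the gap to the minimum keeps the integrands nonnegative, so integrals of
    [F (x t) - min F] make sense before they are known to be finite. The recursion is therefore
    first written with sums on both sides, and finiteness is deduced from it.

    The value of [c] is forced: the noise term [M gamma^2 r K / 2] equals [rho c], so [c] is the
    level at which contraction and noise balance. *)

Section Euclidean.
Context {R : realType} {n : nat}.
Implicit Types (x y z v : 'rV[R]_n) (g : 'rV[R]_n -> R).

Lemma dotpC x y : dotp x y = dotp y x.
Proof. by apply: eq_bigr => j _; rewrite mulrC. Qed.

Lemma dotpDl x y z : dotp (x + y) z = dotp x z + dotp y z.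
Proof. by rewrite -big_split; apply: eq_bigr => j _; rewrite mxE mulrDl. Qed.

Lemma dotpZl (a : R) x y : dotp (a *: x) y = a * dotp x y.
Proof. by rewrite mulr_sumr; apply: eq_bigr => j _; rewrite mxE mulrA. Qed.

Lemma dotpDr x y z : dotp x (y + z) = dotp x y + dotp x z.
Proof. by rewrite dotpC dotpDl !(dotpC x). Qed.

Lemma dotpZr (a : R) x y : dotp x (a *: y) = a * dotp x y.
Proof. by rewrite dotpC dotpZl dotpC. Qed.

Lemma dotpNl x y : dotp (- x) y = - dotp x y.
Proof. by rewrite -scaleN1r dotpZl mulN1r. Qed.

Lemma dotpNr x y : dotp x (- y) = - dotp x y.
Proof. by rewrite dotpC dotpNl dotpC. Qed.

Lemma dotp_ge0 x : 0 <= dotp x x.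
Proof. by apply: sumr_ge0 => j _; rewrite -expr2 sqr_ge0. Qed.

Lemma enorm_ge0 x : 0 <= enorm x.
Proof. exact: sqrtr_ge0. Qed.

Lemma sqr_enorm x : enorm x ^+ 2 = dotp x x.
Proof. by rewrite sqr_sqrtr // dotp_ge0. Qed.

Lemma sqr_enormE x : enorm x ^+ 2 = \sum_(j < n) x 0 j ^+ 2.
Proof. by rewrite sqr_enorm; apply: eq_bigr => j _; rewrite expr2. Qed.

Lemma enormZ (a : R) x : enorm (a *: x) = `|a| * enorm x.
Proof.
by rewrite /enorm dotpZl dotpZr mulrA -expr2 sqrtrM ?sqr_ge0 // sqrtr_sqr.
Qed.

Lemma enorm_eq0 x : enorm x = 0 -> x = 0.
Proof.
move=> /(congr1 (fun a => a ^+ 2)); rewrite sqr_enormE expr0n /= => /eqP.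
rewrite psumr_eq0 => [/allP x0|j _]; last exact: sqr_ge0.
apply/rowP => j; have := x0 j (mem_index_enum _).
by rewrite sqrf_eq0 mxE => /eqP.
Qed.

(** Cauchy-Schwarz: the square of [enorm y *: x - enorm x *: y] equals [2 * enorm x * enorm y] times
    the difference of the two sides. Dividing by that factor requires the zero cases to be split
    off. *)
Lemma dotp_le_enorm x y : dotp x y <= enorm x * enorm y.
Proof.
have [/enorm_eq0 ->|x0] := eqVneq (enorm x) 0.
  by rewrite -(scale0r 0) dotpZl enormZ normr0 !mul0r.
have [/enorm_eq0 ->|y0] := eqVneq (enorm y) 0.
  by rewrite -(scale0r 0) dotpZr enormZ normr0 !(mul0r, mulr0).
have xy_gt0 : 0 < enorm x * enorm y by rewrite mulr_gt0 // lt_def enorm_ge0 ?x0 ?y0.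
have := dotp_ge0 (enorm y *: x - enorm x *: y).
rewrite !(dotpDl, dotpDr, dotpNl, dotpNr, dotpZl, dotpZr) -!sqr_enorm (dotpC y x).
move=> h; rewrite -subr_ge0 -(pmulr_rge0 _ xy_gt0) -(pmulr_rge0 _ (ltr0n R 2)).
by apply: le_trans h _; rewrite le_eqVlt; apply/orP; left; apply/eqP; ring.
Qed.

Lemma derive_grad g x v : differentiable g x -> 'D_v g x = dotp (grad g x) v.
Proof.
move=> dg; rewrite deriveE // {1}(row_sum_delta v) linear_sum /=.
by apply: eq_bigr => j _; rewrite linearZ /= mxE deriveE // mulrC.
Qed.

(** In dimension zero all norms vanish and every [M] qualifies; a positive dimension supplies two
    points at positive distance. *)
Lemma lipschitz_gradient_ge0 (M : R) g : (0 < n)%N ->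
  lipschitz_gradient M g -> 0 <= M.
Proof.
move=> n0 lipg; have := lipg (const_mx 1) 0.
rewrite subr0 => /(le_trans (enorm_ge0 _)); rewrite pmulr_lge0 //.
rewrite lt_def enorm_ge0 andbT; apply/eqP => /enorm_eq0 /rowP /(_ (Ordinal n0)).
by rewrite !mxE; apply/eqP/oner_neq0.
Qed.

(* Along the segment from [x] to [x + v], the derivative of the difference of
   both sides is [dotp (grad g (x + s v) - grad g x) v - M s |v|^2 <= 0]. *)
Lemma descent_le (M : R) g x v : (forall z, differentiable g z) ->
  lipschitz_gradient M g ->
  g (x + v) <= g x + dotp (grad g x) v + M / 2 * enorm v ^+ 2.
Proof.
move=> dg lipg.
pose b := dotp (grad g x) v; pose c := M / 2 * enorm v ^+ 2.
pose h (s : R) : R := g (x + s *: v) - (s * b + s ^+ 2 * c).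
have dline s : is_derive s (1 : R) (fun s : R => g (x + s *: v))
    (dotp (grad g (x + s *: v)) v).
  rewrite -derive_grad //.
  have dd : derivable g (x + s *: v) v by exact: diff_derivable.
  pose l s : R := g (x + s *: v).
  (* The difference quotient of the restriction to the line, in direction [1], is the quotient of
     [g] in direction [v]; derivability and value transfer without a chain rule. *)
  have quotE : (fun t : R => t^-1 *: (l \o shift s) (t *: (1 : R)) - t^-1 *: l s) =
      (fun t : R => t^-1 *: (g \o shift (x + s *: v)) (t *: v) -
                    t^-1 *: g (x + s *: v)).
    apply/funext => t /=; congr (_ *: g _ - _).
    by rewrite scalerDl /GRing.scale /= mulr1 addrCA addrC.
  split.
    rewrite /derivable; move: dd; rewrite /derivable.
    under eq_fun do rewrite scalerBr.
    under [in X in _ -> X]eq_fun do rewrite scalerBr.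
    by rewrite quotE.
  rewrite /derive.
  under eq_fun do rewrite scalerBr.
  under [in RHS]eq_fun do rewrite scalerBr.
  by rewrite quotE.
have dh s : is_derive s (1 : R) h
    (dotp (grad g (x + s *: v)) v - (b + 2 * s * c)).
  rewrite /h; apply: is_deriveB.
  apply: is_derive_eq.
  rewrite /GRing.scale /=; ring.
have dh0 s : 0 <= s -> (dotp (grad g (x + s *: v)) v - (b + 2 * s * c)) <= 0.
  move=> s0; rewrite opprD addrA -dotpNl -dotpDl subr_le0.
  apply: le_trans (dotp_le_enorm _ _) _.
  apply: le_trans (ler_wpM2r (enorm_ge0 _) (lipg _ _)) _.
  rewrite addrAC subrr add0r enormZ ger0_norm // /c.
  by rewrite le_eqVlt; apply/orP; left; apply/eqP; field.
have : h 1 <= h 0.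
  apply: (@ler0_derive1_nincr _ h 0 1) => //.
  - by move=> s; rewrite in_itv /= => /andP[/ltW s0 _]; rewrite derive1E derive_val dh0.
  - by apply: derivable_within_continuous => s _.
rewrite /h scale0r scale1r addr0 !mul0r mul1r expr0n expr1n mul0r mul1r addr0 subr0.
by rewrite lerBlDr addrA.
Qed.

(* Minimizing the strong convexity lower bound at [x] over the second point. *)
Lemma polyak_lojasiewicz (m : R) g x y : 0 < m -> strongly_convex m g ->
  2 * m * (g x - g y) <= enorm (grad g x) ^+ 2.
Proof.
move=> m0 /(_ y x); move: (y - x) => v.
have := dotp_ge0 (grad g x + m *: v).
rewrite !(dotpDl, dotpDr, dotpZl, dotpZr) -!sqr_enorm (dotpC v).
set a := enorm (grad g x) ^+ 2; set b := enorm v ^+ 2; set c := dotp _ _.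
move=> h1 h2.
have : 2 * m * (g x + c + m / 2 * b) <= 2 * m * g y.
  by rewrite ler_pM2l // mulr_gt0.
have -> : 2 * m * (g x + c + m / 2 * b) = 2 * m * g x + (c *+ 2 * m + m * (m * b)).
  by field.
move: h1; rewrite mulrBr mulr2n; lra.
Qed.

End Euclidean.

(** * Measurability along random points *)

Section Caratheodory.
Context {d : measure_display} {T : measurableType d} {R : realType} {n : nat}.
Implicit Types (X : T -> 'rV[R]_n) (g : 'rV[R]_n -> T -> R).

(** A grid point is named by an integer vector because ['rV[int]_n] is countable, which makes unions
    over all cells measurable. *)
Let grid (k : nat) (z : 'rV[int]_n) : 'rV[R]_n :=
  \row_j ((z 0 j)%:~R / k.+1%:R).

Let cell (k : nat) (x : 'rV[R]_n) : 'rV[int]_n :=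
  \row_j Num.floor (x 0 j * k.+1%:R).

Let cvg_grid (x : 'rV[R]_n) : grid k (cell k x) @[k --> \oo] --> x.
Proof.
apply/cvgrPdist_lt => e e0; near=> k.
rewrite -[ltLHS]/(mx_norm _) mx_normrE; apply/bigmax_ltP; split=> // -[i j] _ /=.
have k0 : 0 < k.+1%:R :> R by rewrite ltr0n.
have /andP[h1 h2] := floor_itv (x 0 j * k.+1%:R).
rewrite !mxE ord1 ger0_norm ?subr_ge0 ?ler_pdivrMr //.
apply: (@le_lt_trans _ _ k.+1%:R^-1); last first.
  by near: k; exact: (near_infty_natSinv_lt (PosNum e0)).
rewrite lerBlDr -[X in X + _]mul1r -mulrDl ler_pdivlMr // (le_trans (ltW h2)) //.
by rewrite intrD addrC lexx.
Unshelve. all: by end_near. Qed.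

Let measurable_cell X k z : (forall j, measurable_fun setT (fun w => X w 0 j)) ->
  measurable [set w | cell k (X w) = z].
Proof.
move=> mX; rewrite (_ : [set _ | _] = \big[setI/setT]_(j < n)
    ((fun w => X w 0 j * k.+1%:R) @^-1` `[(z 0 j)%:~R, (z 0 j + 1)%:~R[%classic)).
  apply: bigsetI_measurable => j _; rewrite -[X in measurable X]setTI.
  by apply: measurable_funM => //; exact: mX.
rewrite -bigcap_seq; apply/seteqP; split => [w /= <- j _ /=|w /= wz].
  by rewrite mxE in_itv /= floor_itv.
apply/rowP => j; rewrite mxE; apply/eqP; rewrite floor_eq.
by have := wz j (mem_index_enum j); rewrite /= in_itv.
Qed.

(** It suffices to treat an open [U]. It is the union, over [k], of the cells of side [1 / (k + 1)]
    that lie wholly inside [U], and these are countably many. *)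
Lemma borel_random_coord X : (forall j, measurable_fun setT (fun w => X w 0 j)) ->
  borel_random X.
Proof.
move=> mX; rewrite /borel_random /sigma_of /borel -g_sigma_preimageE.
apply: smallest_sub; first exact: sigma_algebra_measurable.
move=> _ [U oU <-]; rewrite setTI.
rewrite (_ : X @^-1` U = \bigcup_k \bigcup_(z : 'rV[int]_n)
    ([set w | cell k (X w) = z] `&` [set w | forall y, cell k y = z -> U y])).
  apply: bigcupT_measurable => k; apply: countable_bigcupT_measurable => // z.
  apply: measurableI; first exact: measurable_cell.
  have [h|h] := pselect (forall y, cell k y = z -> U y).
    by rewrite (_ : [set _ | _] = setT) //; apply/seteqP; split.
  by rewrite (_ : [set _ | _] = set0) //; apply/seteqP; split.
apply/seteqP; split => [w /= UXw|w [k _ [z _ [/= wz]]]]; last exact.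
have /nbhs_ballP[e /= e0 eU] : nbhs (X w) U by exact: open_nbhs_nbhs.
have [k _ ke] := near_infty_natSinv_lt (PosNum e0).
exists k => //; exists (cell k (X w)) => //; split => // y ykX.
apply: eU; split => // i j; rewrite ord1 /ball /=.
apply: lt_trans (ke k (leqnn k)); have k0 : 0 < k.+1%:R :> R by rewrite ltr0n.
have := floor_itv (X w 0 j * k.+1%:R); have := floor_itv (y 0 j * k.+1%:R).
move/rowP : ykX => /(_ j); rewrite !mxE => ->.
rewrite intrD -[_^-1]mul1r ltr_pdivlMr //.
rewrite (_ : `|_| * _ = `|X w 0 j * k.+1%:R - y 0 j * k.+1%:R|); last first.
  by rewrite -mulrBl normrM (ger0_norm (ltW k0)).
by rewrite ltr_norml; lra.
Qed.

(* Rounding the random point to a grid leaves countably many cases. *)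
Lemma measurable_caratheodory X g :
  (forall j, measurable_fun setT (fun w => X w 0 j)) ->
  (forall x, measurable_fun setT (g x)) ->
  (forall w, continuous (g^~ w)) ->
  measurable_fun setT (fun w => g (X w) w).
Proof.
move=> mX mg cg.
apply: (@measurable_fun_cvg _ _ _ _ (fun k w => g (grid k (cell k (X w))) w)).
  move=> k _ U mU; rewrite setTI.
  rewrite (_ : _ @^-1` _ = \bigcup_(z : 'rV[int]_n)
      ([set w | cell k (X w) = z] `&` (g (grid k z)) @^-1` U)); last first.
    apply/seteqP; split => [w gU|w [z _ [/= <-]]] //.
    by exists (cell k (X w)).
  apply: countable_bigcupT_measurable => // z.
  apply: measurableI; first exact: measurable_cell.
  by rewrite -[X in measurable X]setTI; exact: mg.
move=> w _; apply: (@cvg_comp _ _ _ (fun k => grid k (cell k (X w))) (g^~ w)).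
  exact: cvg_grid.
exact: cg.
Qed.

(** A partial derivative is the limit of difference quotients with increments [1 / (k + 1)], each
    measurable by [measurable_caratheodory]. *)
Lemma measurable_grad X g :
  (forall j, measurable_fun setT (fun w => X w 0 j)) ->
  (forall x, measurable_fun setT (g x)) ->
  (forall w x, differentiable (g^~ w) x) ->
  forall j, measurable_fun setT (fun w => grad (g^~ w) (X w) 0 j).
Proof.
move=> mX mg dg j.
have cg w : continuous (g^~ w) by move=> x; exact: differentiable_continuous.
apply: (@measurable_fun_cvg _ _ _ _ (fun k w =>
    k.+1%:R * (g (k.+1%:R^-1 *: delta_mx 0 j + X w) w - g (X w) w))).
  move=> k; apply: measurable_funM => //; apply: measurable_funB.
    apply: (@measurable_caratheodory
      (fun w => k.+1%:R^-1 *: delta_mx 0 j + X w) g) => // i.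
    under eq_fun do rewrite mxE.
    by apply: measurable_funD => //; exact: measurable_cst.
  exact: measurable_caratheodory.
move=> w _; rewrite mxE.
have /cvg_ex[l lP] : derivable (g^~ w) (X w) (delta_mx 0 j) by exact: diff_derivable.
have -> : 'D_(delta_mx 0 j) (g^~ w) (X w) = l by exact/cvg_lim.
move/cvgr_dnbhsP : lP => /(_ (fun k => k.+1%:R^-1)) lP.
under eq_fun do rewrite -[X in X * _]invrK.
by apply: lP; split; [move=> k; rewrite invr_eq0 pnatr_eq0|exact: cvg_harmonic].
Qed.

End Caratheodory.

(** * Independence *)

Section Independence.
Local Open Scope ereal_scope.
Context {d : measure_display} {Omega : measurableType d} {R : realType}.
Variable P : probability Omega R.
Implicit Types G H : set (set Omega).

Lemma independent2_sym G H : independent2 P G H -> independent2 P H G.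
Proof. by move=> GH A C HA GC; rewrite setIC muleC GH. Qed.

(** For fixed [C], the finite measures sending [A] to [P (A]&[C)] and to [P C * P A] agree on the
    pi-system [G], hence on the sigma-algebra it generates. *)
Lemma independent2_g_sigma_left G H :
  G `<=` measurable -> H `<=` measurable -> setI_closed G -> G setT ->
  independent2 P G H -> independent2 P <<s G >> H.
Proof.
move=> mG mH GI GT GH A C GA HC.
have mC : measurable C by exact: mH.
pose k : {nonneg R} := NngNum (fine_ge0 (measure_ge0 P C)).
have := @g_sigma_algebra_measure_unique _ _ _ G mG (fun=> setT) (fun=> GT) _
  (mrestr P mC) (mscale k P) GI _ _ A GA.
rewrite /= /mrestr /mscale /= fineK ?fin_num_measure // muleC; apply.
- by rewrite bigcup_const.
- by move=> D GD /=; rewrite GH // muleC.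
- by move=> _; rewrite setTI -ge0_fin_numE // fin_num_measure.
Qed.

Lemma independent2_g_sigma G H :
  G `<=` measurable -> H `<=` measurable ->
  setI_closed G -> setI_closed H -> G setT -> H setT ->
  independent2 P G H -> independent2 P <<s G >> <<s H >>.
Proof.
move=> mG mH GI HI GT HT GH.
have smG : <<s G >> `<=` measurable.
  by apply: smallest_sub => //; exact: sigma_algebra_measurable.
apply: independent2_sym; apply: independent2_g_sigma_left => //.
by apply: independent2_sym; exact: independent2_g_sigma_left.
Qed.

(* A pi-system generating the join of the [D j], [j] in [S]. *)
Definition finite_meets (J : choiceType) (D : J -> set (set Omega))
    (S : set J) : set (set Omega) :=
  [set A | exists s f, [/\ uniq s, forall j, j \in s -> S j /\ D j (f j) &
             A = \big[setI/setT]_(j <- s) f j]].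

Section FiniteMeets.
Context {J : choiceType} (D : J -> set (set Omega)).
Hypothesis DT : forall j, D j setT.
Hypothesis DI : forall j, setI_closed (D j).
Hypothesis mD : forall j, D j `<=` measurable.
Implicit Type S : set J.

Lemma finite_meetsT S : finite_meets D S setT.
Proof. by exists [::], (fun=> setT); split => //; rewrite big_nil. Qed.

Lemma sub_finite_meets S j : S j -> D j `<=` finite_meets D S.
Proof.
move=> Sj A DA; exists [:: j], (fun=> A); split => //; last by rewrite big_seq1.
by move=> i; rewrite inE => /eqP ->.
Qed.

Lemma finite_meets_subset S1 S2 : S1 `<=` S2 ->
  finite_meets D S1 `<=` finite_meets D S2.
Proof.
move=> S12 A [s [f [us sf ->]]]; exists s, f; split => // j /sf[? ?].
by split => //; exact: S12.
Qed.

Lemma finite_meets_measurable S : finite_meets D S `<=` measurable.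
Proof.
move=> A [s [f [us sf ->]]]; rewrite -bigcap_seq; apply: fin_bigcap_measurable.
  exact: finite_seq.
by move=> j /= /sf[_ /mD].
Qed.

Lemma setI_closed_finite_meets S : setI_closed (finite_meets D S).
Proof.
move=> _ _ [s1 [f1 [u1 sf1 ->]]] [s2 [f2 [u2 sf2 ->]]].
(* Padding with [setT] lets both families be indexed by the merged list, where a common index
   receives an intersection inside one [D j]. *)
pose g (s : seq J) (f : J -> set Omega) j := if j \in s then f j else setT.
exists (undup (s1 ++ s2)), (fun j => g s1 f1 j `&` g s2 f2 j).
split; first exact: undup_uniq.
  move=> j; rewrite mem_undup mem_cat => js; split.
    by case/orP: js => [/sf1[]|/sf2[]].
  apply: DI; rewrite /g.
    by case: ifP => // /sf1[].
  by case: ifP => // /sf2[].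
rewrite -!bigcap_seq; apply/seteqP; split => w.
  move=> [h1 h2] j _; split; rewrite /g; case: ifP => // js; [exact: h1|exact: h2].
move=> h; split => j /= js; have := h j;
  rewrite /= mem_undup mem_cat js ?orbT => /(_ isT).
  by case; rewrite /g js.
by case; rewrite /g js.
Qed.

Lemma independent2_finite_meets S1 S2 : mutually_independent P D ->
  [disjoint S1 & S2] ->
  independent2 P (finite_meets D S1) (finite_meets D S2).
Proof.
move=> indD S12 _ _ [s1 [f1 [u1 sf1 ->]]] [s2 [f2 [u2 sf2 ->]]].
have s12 j : j \in s2 -> j \notin s1.
  move=> /sf2[S2j _]; apply/negP => /sf1[S1j _].
  by have /disj_setPS /(_ j) := S12; apply.
(* Disjointness makes the concatenated list duplicate-free, so mutual independence applies to it as
   well as to each half. *)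
pose f j := if j \in s1 then f1 j else f2 j.
have f1E : {in s1, f =1 f1} by move=> j js; rewrite /f js.
have f2E : {in s2, f =1 f2} by move=> j /s12 js; rewrite /f (negbTE js).
have <- : \big[setI/setT]_(j <- s1) f j = \big[setI/setT]_(j <- s1) f1 j.
  by rewrite big_seq [RHS]big_seq; apply: eq_bigr.
have <- : \big[setI/setT]_(j <- s2) f j = \big[setI/setT]_(j <- s2) f2 j.
  by rewrite big_seq [RHS]big_seq; apply: eq_bigr.
rewrite -big_cat /= !indD //= ?big_cat //=.
- by move=> j js; rewrite f2E //; case: (sf2 j js).
- by move=> j js; rewrite f1E //; case: (sf1 j js).
- by rewrite cat_uniq u1 u2 andbT; apply/hasPn => j /s12.
- move=> j; rewrite mem_cat /f; case: ifP => [/sf1[] //|_ /= /sf2[] //].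
Qed.

Lemma independent2_sigma_finite_meets S1 S2 : mutually_independent P D ->
  [disjoint S1 & S2] ->
  independent2 P <<s finite_meets D S1 >> <<s finite_meets D S2 >>.
Proof.
move=> indD S12; apply: independent2_g_sigma.
- exact: finite_meets_measurable.
- exact: finite_meets_measurable.
- exact: setI_closed_finite_meets.
- exact: setI_closed_finite_meets.
- exact: finite_meetsT.
- exact: finite_meetsT.
- exact: independent2_finite_meets.
Qed.

End FiniteMeets.

End Independence.

(** * Integration of functions of independent variables *)

Section IntegralIndependence.
Local Open Scope ereal_scope.
Context {d d1 d2 : measure_display} {Omega : measurableType d}
  {T1 : measurableType d1} {T2 : measurableType d2} {R : realType}.
Variable P : probability Omega R.

(** Independence says that the law of the pair agrees with the product of the two laws on
    rectangles, hence everywhere; Tonelli then separates the variables. *)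
Lemma integral_independent (X : Omega -> T1) (Y : Omega -> T2)
    (phi : T1 * T2 -> \bar R) :
  measurable_fun setT X -> measurable_fun setT Y ->
  (forall A C, measurable A -> measurable C ->
    P (X @^-1` A `&` Y @^-1` C) = P (X @^-1` A) * P (Y @^-1` C)) ->
  measurable_fun setT phi -> (forall z, 0 <= phi z) ->
  \int[P]_w phi (X w, Y w) = \int[P]_w \int[P]_w' phi (X w, Y w').
Proof.
move=> mX mY XY mphi phi0.
pose X' : {mfun Omega >-> T1} := HB.pack X (isMeasurableFun.Build _ _ _ _ _ mX).
pose Y' : {mfun Omega >-> T2} := HB.pack Y (isMeasurableFun.Build _ _ _ _ _ mY).
have mXY : measurable_fun setT (fun w => (X w, Y w)) by exact: measurable_fun_pair.
pose XY' : {mfun Omega >-> (T1 * T2)%type} :=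
  HB.pack (fun w => (X w, Y w)) (isMeasurableFun.Build _ _ _ _ _ mXY).
have -> : \int[P]_w phi (X w, Y w) = \int[distribution P XY']_z phi z.
  by rewrite ge0_integral_distribution.
have -> : \int[distribution P XY']_z phi z =
    \int[distribution P X' \x distribution P Y']_z phi z.
  apply: eq_measure_integral => A mA _; apply/esym.
  by apply: product_measure_unique => // B C mB mC; exact: (XY B C).
rewrite fubini_tonelli1 // /fubini_F ge0_integral_distribution //=.
- apply: eq_integral => w _ /=.
  by rewrite ge0_integral_distribution //=; exact: measurableT_comp.
- exact: measurable_fun_fubini_tonelli_F.
- by move=> y; apply: integral_ge0.
Qed.

Lemma measurable_integral_snd (Y : Omega -> T2) (phi : T1 * T2 -> \bar R) :
  measurable_fun setT Y -> measurable_fun setT phi -> (forall z, 0 <= phi z) ->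
  measurable_fun setT (fun z => \int[P]_w phi (z, Y w)).
Proof.
move=> mY mphi phi0.
pose Y' : {mfun Omega >-> T2} := HB.pack Y (isMeasurableFun.Build _ _ _ _ _ mY).
have := measurable_fun_fubini_tonelli_F (m2 := distribution P Y') phi mphi phi0.
congr measurable_fun; apply/funext => z /=.
by rewrite /fubini_F ge0_integral_distribution //=; exact: measurableT_comp.
Qed.

End IntegralIndependence.

Section MeasurableIntegral.
Local Open Scope ereal_scope.
Context {d : measure_display} {Omega : measurableType d} {R : realType}.
Variable mu : {measure set Omega -> \bar R}.

Lemma le_measurable_integral (A : set Omega) (g h : Omega -> \bar R) :
  measurable A -> measurable_fun A g -> measurable_fun A h ->
  (forall w, A w -> g w <= h w) ->
  \int[mu]_(w in A) g w <= \int[mu]_(w in A) h w.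
Proof.
move=> mA mg mh gh; rewrite integralE [leRHS]integralE.
have gh' : {in A, forall w, g w <= h w} by move=> w; rewrite inE; exact: gh.
apply: leeB; apply: ge0_le_integral => //; try exact: measurable_funepos;
  try exact: measurable_funeneg; move=> w /mem_set Aw.
  exact: funepos_le gh' _ Aw.
exact: funeneg_le gh' _ Aw.
Qed.

(** [g] carries no sign or integrability assumption, so it is compared through its truncation at
    [K], which equals it almost everywhere and is bounded everywhere. *)
Lemma ae_le_integral_cst (A : set Omega) (g : Omega -> \bar R) (K : R) :
  measurable A -> measurable_fun setT g -> {ae mu, forall w, g w <= K%:E} ->
  \int[mu]_(w in A) g w <= K%:E * mu A.
Proof.
move=> mA mg gK; rewrite -integral_cst //.
have mg' : measurable_fun setT (fun w => mine (g w) K%:E).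
  by apply: measurable_mine => //; exact: measurable_cst.
rewrite (@ae_eq_integral _ _ _ mu A (fun w => mine (g w) K%:E) g) //.
- apply: le_measurable_integral => //; first exact: measurable_funTS.
  by move=> w _ /=; rewrite ge_min lexx orbT.
- exact: measurable_funTS.
- exact: measurable_funTS.
- by apply: filterS gK => w gw _; rewrite min_l.
Qed.

End MeasurableIntegral.

Section IntegralRestriction.
Local Open Scope ereal_scope.
Context {d d1 : measure_display} {Omega : measurableType d}
  {T : measurableType d1} {R : realType}.
Variable P : probability Omega R.

Lemma ge0_integral_independent_set (A : set Omega) (Y : Omega -> T)
    (phi : T -> \bar R) :
  measurable A -> measurable_fun setT Y ->
  (forall C, measurable C -> P (A `&` Y @^-1` C) = P A * P (Y @^-1` C)) ->
  measurable_fun setT phi -> (forall z, 0 <= phi z) ->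
  \int[P]_(w in A) phi (Y w) = P A * \int[P]_w phi (Y w).
Proof.
move=> mA mY AY mphi phi0.
(* Turning the event into a boolean random variable reduces the claim to [integral_independent];
   independence is then checked on the four subsets of [bool]. *)
pose b w := w \in A.
have mb : measurable_fun setT b.
  apply: (measurable_fun_bool true); rewrite setTI (_ : _ @^-1` _ = A) //.
  by apply/seteqP; split => w /=; [move/set_mem|move/mem_set].
have bE (g : Omega -> \bar R) :
    \int[P]_(w in A) g w = \int[P]_w (if b w then g w else 0).
  by rewrite integral_mkcond; apply: eq_integral => w _; rewrite patchE.
rewrite bE.
pose psi (z : bool * T) := if z.1 then phi z.2 else 0.
have mpsi : measurable_fun setT psi.
  apply: measurable_fun_ifT => //; exact: measurableT_comp.
rewrite (@integral_independent _ _ _ _ _ _ _ P b Y psi) //; first last.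
- by move=> z; rewrite /psi; case: ifP.
- move=> B C mB mC.
  have mYC : measurable (Y @^-1` C) by rewrite -[X in measurable X]setTI; exact: mY.
  have bA : b @^-1` [set true] = A.
    by apply/seteqP; split => w /=; rewrite /b -[A w]inE => ->.
  have [Bt|Bt] := pselect (B true); have [Bf|Bf] := pselect (B false).
  + rewrite (_ : b @^-1` B = setT); last by apply/seteqP; split => w //= _; case: (b w).
    by rewrite setTI probability_setT mul1e.
  + rewrite (_ : b @^-1` B = A) ?AY // -bA.
    by apply/seteqP; split => w /=; [case: (b w)|move=> ->].
  + rewrite (_ : b @^-1` B = ~` A); last first.
      by rewrite -bA; apply/seteqP; split => w /=; case: (b w) => // _.
    rewrite setIC -setDE measureD ?ltey_eq ?fin_num_measure //.
    rewrite [X in _ - X](_ : _ = P A * P (Y @^-1` C)); last first.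
      by rewrite setIC; exact: AY.
    rewrite probability_setC // muleBl ?mul1e // ?fin_num_measure //.
  + rewrite (_ : b @^-1` B = set0); last by apply/seteqP; split => w //=; case: (b w).
    by rewrite set0I measure0 mul0e.
under eq_integral => w _.
  rewrite (_ : \int[P]_w' _ = if b w then \int[P]_w phi (Y w) else 0); last first.
    by rewrite /psi /=; case: (b w) => //; rewrite integral0.
  over.
by rewrite -bE integral_cst // muleC.
Qed.

Lemma integral_independent_set (A : set Omega) (Y : Omega -> T) (phi : T -> \bar R) :
  measurable A -> measurable_fun setT Y ->
  (forall C, measurable C -> P (A `&` Y @^-1` C) = P A * P (Y @^-1` C)) ->
  measurable_fun setT phi -> P.-integrable setT (phi \o Y) ->
  \int[P]_(w in A) phi (Y w) = P A * \int[P]_w phi (Y w).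
Proof.
move=> mA mY AY mphi iphi; rewrite integralE [in RHS]integralE.
have pE := funepos_comp phi Y; have nE := funeneg_comp phi Y.
rewrite -![fun w => phi (Y w)]/(phi \o Y) pE nE !(@ge0_integral_independent_set A Y) //.
- rewrite [RHS]muleBr ?fin_num_measure //.
  by apply: fin_num_adde_defr; rewrite -pE integrable_pos_fin_num.
- exact: measurable_funeneg.
- exact: measurable_funepos.
Qed.

End IntegralRestriction.

(** * Expected descent of one step *)

Section HasMean.
Context {d : measure_display} {Omega : measurableType d} {R : realType}.
Variable P : probability Omega R.
Implicit Types X Y : Omega -> R.

(** Bundling integrability with a real value lets means be added and scaled without side conditions
    in the extended reals. *)
Definition has_mean X (a : R) : Prop :=
  P.-integrable setT (EFin \o X) /\ (\int[P]_w (X w)%:E = a%:E)%E.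

(** A finite extended integral already forces integrability, so unbiasedness carries the
    integrability of the partial derivatives with it. *)
Lemma expectation_has_mean X a : measurable_fun setT X ->
  'E_P[X]%E = a%:E -> has_mean X a.
Proof.
rewrite unlock => mX Xa; split => //.
apply/integrableP; split; first exact/measurable_EFinP.
by rewrite integral_fin_num_abs // Xa.
Qed.

Lemma ge0_has_mean X (a : \bar R) : measurable_fun setT X ->
  (forall w, 0 <= X w) -> (\int[P]_w (X w)%:E <= a)%E -> (a < +oo)%E ->
  exists2 b, has_mean X b & (b%:E <= a)%E.
Proof.
move=> mX X0 Xa aoo; exists (fine (\int[P]_w (X w)%:E)%E); last first.
  rewrite fineK // ge0_fin_numE ?(le_lt_trans Xa) //.
  by apply: integral_ge0 => w _; rewrite lee_fin.
have Xfin : (\int[P]_w (X w)%:E)%E \is a fin_num.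
  rewrite ge0_fin_numE ?(le_lt_trans Xa) //.
  by apply: integral_ge0 => w _; rewrite lee_fin.
apply: expectation_has_mean => //; by rewrite unlock fineK.
Qed.

Lemma has_mean_cst a : has_mean (fun=> a) a.
Proof.
split; first by apply: finite_measure_integrable_cst.
by rewrite integral_cst // [X in (_ * X)%E]probability_setT mule1.
Qed.

Lemma has_meanD X Y a b :
  has_mean X a -> has_mean Y b -> has_mean (fun w => X w + Y w) (a + b).
Proof.
move=> [iX Xa] [iY Yb]; split; first exact: (integrableD _ iX iY).
by under eq_integral do rewrite EFinD; rewrite integralD // Xa Yb.
Qed.

Lemma has_meanZ (k : R) X a : has_mean X a -> has_mean (fun w => k * X w) (k * a).
Proof.
move=> [iX Xa]; split; first exact: (integrableZl _ k iX).
by under eq_integral do rewrite EFinM; rewrite integralZl // Xa.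
Qed.

Lemma has_mean_sum (I : Type) (s : seq I) (X : I -> Omega -> R) (a : I -> R) :
  (forall i, has_mean (X i) (a i)) ->
  has_mean (fun w => \sum_(i <- s) X i w) (\sum_(i <- s) a i).
Proof.
move=> Xa; elim: s => [|i s IH].
  rewrite big_nil; under [X in has_mean X]eq_fun do rewrite big_nil.
  exact: has_mean_cst.
rewrite big_cons; under [X in has_mean X]eq_fun do rewrite big_cons.
exact: has_meanD.
Qed.

End HasMean.

Section MeanTransfer.
Context {d d1 : measure_display} {Omega : measurableType d}
  {T : measurableType d1} {R : realType}.
Variable P : probability Omega R.

Lemma has_mean_same_law (X Y : Omega -> T) (phi : T -> R) a :
  measurable_fun setT X -> measurable_fun setT Y -> measurable_fun setT phi ->
  (forall C, measurable C -> P (X @^-1` C) = P (Y @^-1` C)) ->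
  has_mean P (phi \o X) a -> has_mean P (phi \o Y) a.
Proof.
move=> mX mY mphi XY.
pose X' : {mfun Omega >-> T} := HB.pack X (isMeasurableFun.Build _ _ _ _ _ mX).
pose Y' : {mfun Omega >-> T} := HB.pack Y (isMeasurableFun.Build _ _ _ _ _ mY).
have E (g : T -> \bar R) : (measurable_fun setT g -> (forall z, 0 <= g z) ->
    \int[P]_w g (X w) = \int[P]_w g (Y w))%E.
  move=> mg g0.
  rewrite -[LHS](@ge0_integral_distribution _ _ _ _ _ P X' g) //.
  rewrite -[RHS](@ge0_integral_distribution _ _ _ _ _ P Y' g) //.
  by apply: eq_measure_integral => C mC _; exact: (XY C).
have mphiE : measurable_fun setT (EFin \o phi) by exact/measurable_EFinP.
move=> [/integrableP[_ iX] Xa]; split.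
  apply/integrableP; split; first exact/measurable_EFinP/measurableT_comp.
  have h : measurable_fun setT (abse \o (EFin \o phi)) by exact: measurableT_comp.
  by rewrite -[X in (X < _)%E](E _ h) // => z; exact: abse_ge0.
rewrite -Xa [LHS]integralE [RHS]integralE.
have ZE Z : (fun w : Omega => ((phi \o Z) w)%:E) = (EFin \o phi) \o Z by [].
rewrite !ZE (funepos_comp _ X) (funepos_comp _ Y) (funeneg_comp _ X).
rewrite (funeneg_comp _ Y); congr (_ - _)%E; apply/esym.
  by apply: E => //; exact: measurable_funepos.
by apply: E => //; exact: measurable_funeneg.
Qed.

Lemma has_mean_independent_set (A : set Omega) (Y : Omega -> T) (phi : T -> R)
    (p a : R) :
  measurable A -> measurable_fun setT Y -> measurable_fun setT phi ->
  (forall C, measurable C -> P (A `&` Y @^-1` C) = (P A * P (Y @^-1` C))%E) ->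
  P A = p%:E -> has_mean P (phi \o Y) a ->
  has_mean P (fun w => if w \in A then phi (Y w) else 0) (p * a).
Proof.
move=> mA mY mphi AY PA [iY Ya].
have patch : (fun w => (if w \in A then phi (Y w) else 0)%:E) =
    ((EFin \o phi \o Y) \_ A)%E.
  by apply/funext => w; rewrite patchE; case: ifP.
split.
  rewrite -[X in P.-integrable _ X]/(fun w =>
    (if w \in A then phi (Y w) else 0)%:E) patch.
  apply/(integrable_mkcond (EFin \o phi \o Y) mA).
  exact: (@integrableS _ _ _ P setT).
rewrite patch -integral_mkcond.
rewrite (@integral_independent_set _ _ _ _ _ P A Y (EFin \o phi)) //.
  by rewrite PA Ya EFinM.
exact/measurable_EFinP.
Qed.

End MeanTransfer.

(** Nonnegativity of the empirical variance. It is the reason why [L] disappears from the final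
    bound: averaging a batch does not increase the second moment. *)
Lemma sqr_mean_le (R : realType) (L : nat) (a : 'I_L -> R) : (0 < L)%N ->
  (L%:R^-1 * \sum_(l < L) a l) ^+ 2 <= L%:R^-1 * \sum_(l < L) a l ^+ 2.
Proof.
move=> L0; have Lr : 0 < L%:R :> R by rewrite ltr0n.
set s := \sum_(l < L) a l; set q := \sum_(l < L) _.
have : 0 <= \sum_(l < L) (a l - L%:R^-1 * s) ^+ 2.
  by apply: sumr_ge0 => l _; exact: sqr_ge0.
have -> : \sum_(l < L) (a l - L%:R^-1 * s) ^+ 2 = q - L%:R^-1 * s ^+ 2.
  under eq_bigr do rewrite sqrrB.
  rewrite big_split sumrB /= -/q sumr_const card_ord sumrMnl -mulr_suml -/s.
  rewrite -(mulr_natr _ L) -(mulr_natr _ 2); field.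
  by rewrite gt_eqF.
rewrite subr_ge0 => h.
by rewrite exprMn expr2 -mulrA ler_pM2l ?invr_gt0.
Qed.

Section Step.
Context {R : realType} {n B L : nat} {T : Type} (blk : 'I_n -> 'I_B).
Variable f : 'rV[R]_n -> T -> R.

(** Indexing by flat coordinates, with [blk j] the block of [j], makes the update a single vector
    subtraction. *)
Definition block_direction (x : 'rV[R]_n) (S : {set 'I_B})
    (batch : 'I_B -> 'I_L -> T) : 'rV[R]_n :=
  \row_j (if blk j \in S
          then L%:R^-1 * \sum_(l < L) grad (f^~ (batch (blk j) l)) x 0 j else 0).

Lemma sqr_block_direction_le x S batch j : (0 < L)%N ->
  (block_direction x S batch 0 j) ^+ 2 <=
  if blk j \in S
  then L%:R^-1 * \sum_(l < L) (grad (f^~ (batch (blk j) l)) x 0 j) ^+ 2 else 0.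
Proof.
by move=> L0; rewrite mxE; case: ifP => _; [exact: sqr_mean_le|rewrite expr0n].
Qed.

End Step.

Section OneStep.
Context {R : realType} {n B L : nat} {d d1 : measure_display}
  {Omega : measurableType d} {T : measurableType d1}.
Variables (P : probability Omega R) (blk : 'I_n -> 'I_B).
Variables (f : 'rV[R]_n -> T -> R) (F : 'rV[R]_n -> R).
Variables (theta : Omega -> T) (Is : Omega -> {set 'I_B})
  (xi : 'I_B -> 'I_L -> Omega -> T).
Variables (gamma r M K : R) (x y : 'rV[R]_n).
Hypothesis n0 : (0 < n)%N.
Hypothesis L0 : (0 < L)%N.
Hypothesis mf : forall x, measurable_fun setT (f x).
Hypothesis df : forall th x, differentiable (f^~ th) x.
Hypothesis dF : forall x, differentiable F x.
Hypothesis mtheta : measurable_fun setT theta.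
Hypothesis mxi : forall i l, measurable_fun setT (xi i l).
Hypothesis mIs : forall i, measurable [set w | i \in Is w].
Hypothesis PIs : forall i, P [set w | i \in Is w] = r%:E.
Hypothesis xi_law : forall i l C, measurable C ->
  P (theta @^-1` C) = P (xi i l @^-1` C).
Hypothesis xi_Is : forall i l C, measurable C ->
  P ([set w | i \in Is w] `&` xi i l @^-1` C) =
  (P [set w | i \in Is w] * P (xi i l @^-1` C))%E.
Hypothesis unbiased : forall j,
  'E_P[fun w => grad (f^~ (theta w)) x 0%R j]%E = (grad F x 0 j)%:E.
Hypothesis second_moment :
  (\int[P]_w (enorm (grad (f^~ (theta w)) x) ^+ 2)%:E <= K%:E)%E.
Hypothesis Fmin : forall z, F y <= F z.
Hypothesis lipF : lipschitz_gradient M F.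

Let mgrad j : measurable_fun setT (fun th => grad (f^~ th) x 0 j).
Proof.
apply: (measurable_grad (X := fun=> x) (g := f)) => // i.
Qed.

Let r_ge0 : 0 <= r.
Proof.
by rewrite -lee_fin -(PIs (blk (Ordinal n0))) measure_ge0.
Qed.

(** The descent inequality is averaged along the random step. A coordinate moves with probability
    [r], independently of each of its samples, so the linear and the quadratic term both acquire the
    factor [r]. *)
Lemma expected_descent :
  measurable_fun setT
    (fun w => F (x - gamma *: block_direction blk f x (Is w) (fun i l => xi i l w))) ->
  (\int[P]_w (F (x - gamma *: block_direction blk f x (Is w) (fun i l => xi i l w))
       - F y)%:E
   <= (F x - F y - gamma * r * enorm (grad F x) ^+ 2
        + M * gamma ^+ 2 / 2 * r * K)%:E)%E.
Proof.
move=> mFx.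
pose g th j := grad (f^~ th) x 0 j.
pose a j := grad F x 0 j.
have ga j : has_mean P (fun w => g (theta w) j) (a j).
  apply: expectation_has_mean (unbiased j).
  exact: (measurableT_comp (mgrad j) mtheta).
have M0 := lipschitz_gradient_ge0 n0 lipF.
(* Each squared coordinate is dominated by the squared norm and so has a real mean [s j]; these
   means sum to the second moment. *)
have [s sK gs] : exists2 s : 'I_n -> R, \sum_j s j <= K &
    forall j, has_mean P (fun w => g (theta w) j ^+ 2) (s j).
  have mg2 j : measurable_fun setT (fun w => g (theta w) j ^+ 2).
    by apply: measurable_funX; exact: (measurableT_comp (mgrad j) mtheta).
  have le j : (\int[P]_w (g (theta w) j ^+ 2)%:E <= K%:E)%E.
    apply: le_trans second_moment; apply: ge0_le_integral => //.
    - by move=> w _; rewrite lee_fin sqr_ge0.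
    - exact/measurable_EFinP.
    - apply/measurable_EFinP; under eq_fun do rewrite sqr_enormE.
      by apply: measurable_sum => i; exact: mg2.
    - move=> w _; rewrite lee_fin sqr_enormE (bigD1 j) //= lerDl.
      by apply: sumr_ge0 => i _; exact: sqr_ge0.
  have ex i : exists b, has_mean P (fun w => g (theta w) i ^+ 2) b.
    have [|b hb _] := ge0_has_mean (mg2 i) _ (le i) (ltry _).
      by move=> w; exact: sqr_ge0.
    by exists b.
  exists (fun j => sval (cid (ex j))); last by move=> j; case: cid.
  have [_] := has_mean_sum (index_enum 'I_n) (fun j => svalP (cid (ex j))).
  move=> E; rewrite -lee_fin -E; apply: le_trans second_moment.
  rewrite le_eqVlt; apply/orP; left; apply/eqP/eq_integral => w _.
  by rewrite sqr_enormE.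
(* The share of one sample in the descent bound, linear and quadratic part, each with weight
   [1 / L]. A [psi j] reads a single sample, so its mean can be computed under [theta]. *)
pose c1 j := - (gamma * a j / L%:R); pose c2 := M * gamma ^+ 2 / 2 / L%:R.
pose psi j th := c1 j * g th j + c2 * g th j ^+ 2.
pose A i := [set w | i \in Is w].
have mpsi j : measurable_fun setT (psi j).
  apply: measurable_funD; apply: measurable_funM => //; first exact: mgrad.
  by apply: measurable_funX; exact: mgrad.
have psi_mean j l : has_mean P
    (fun w => if w \in A (blk j) then psi j (xi (blk j) l w) else 0)
    (r * (c1 j * a j + c2 * s j)).
  apply: has_mean_independent_set.
  - exact: mIs.
  - exact: mxi.
  - exact: mpsi.
  - by move=> C mC; exact: xi_Is.
  - exact: PIs.
  apply: (@has_mean_same_law _ _ _ _ _ P theta) => //.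
    by move=> C mC; exact: xi_law.
  by apply: has_meanD; apply: has_meanZ.
have W_mean := has_meanD (has_mean_cst P (F x - F y))
  (has_mean_sum (index_enum 'I_n) (fun j =>
     has_mean_sum (index_enum 'I_L) (fun l => psi_mean j l))).
have cM : 0 <= M * gamma ^+ 2 / 2 by rewrite divr_ge0 // mulr_ge0 // sqr_ge0.
have {W_mean} [/integrableP[mW _] WE] := W_mean.
pose dir w := block_direction blk f x (Is w) (fun i l => xi i l w).
have FW w : F (x - gamma *: dir w) - F y <= F x - F y + \sum_j \sum_(l < L)
    (if w \in A (blk j) then psi j (xi (blk j) l w) else 0).
  have sumpsi j : \sum_(l < L) (if w \in A (blk j) then psi j (xi (blk j) l w) else 0) =
      - gamma * (a j * dir w 0 j) + M * gamma ^+ 2 / 2 *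
        (if blk j \in Is w
         then L%:R^-1 * \sum_(l < L) g (xi (blk j) l w) j ^+ 2 else 0).
    rewrite [dir w 0 j]mxE /A.
    have -> : (w \in [set w | blk j \in Is w]) = (blk j \in Is w).
      by apply/idP/idP; rewrite inE.
    case: ifP => _; last by rewrite big1 // !mulr0 addr0.
    rewrite big_split -!mulr_sumr /= /c1 /c2 /g; field.
    by rewrite pnatr_eq0 -lt0n.
  rewrite [leRHS]addrAC lerD2r; apply: le_trans (descent_le x _ dF lipF) _.
  rewrite -addrA lerD2l; under [leRHS]eq_bigr do rewrite sumpsi.
  rewrite big_split -!mulr_sumr /= dotpNr dotpZr mulNr lerD2l.
  rewrite -scaleNr enormZ exprMn normrN real_normK ?num_real // mulrA [M / 2 * _]mulrAC.
  apply: ler_wpM2l => //.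
  by rewrite sqr_enormE; apply: ler_sum => j _; exact: sqr_block_direction_le.
apply: (@le_trans _ _ (\int[P]_w (F x - F y + \sum_j \sum_(l < L)
    (if w \in A (blk j) then psi j (xi (blk j) l w) else 0))%:E)%E).
  apply: ge0_le_integral => //.
  - by move=> w _; rewrite lee_fin subr_ge0.
  - by apply/measurable_EFinP; exact: measurable_funB.
  - by move=> w _; rewrite lee_fin; exact: FW.
rewrite WE lee_fin -[leRHS]addrA lerD2l sqr_enormE.
under eq_bigr do rewrite sumr_const card_ord -mulr_natl.
have Lr : L%:R != 0 :> R by rewrite pnatr_eq0 -lt0n.
have -> : \sum_j L%:R * (r * (c1 j * a j + c2 * s j)) =
    - (gamma * r * \sum_j a j ^+ 2) + M * gamma ^+ 2 / 2 * r * \sum_j s j.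
  rewrite !mulr_sumr -sumrN -big_split /=; apply: eq_bigr => j _.
  by rewrite /c1 /c2; field.
by rewrite lerD2l ler_wpM2l // mulr_ge0.
Qed.

End OneStep.

(** * Sampling, updates and trace sigma-algebras *)

Section Sampling.
Context {d : measure_display} {Omega : measurableType d} {R : realType}.
Variables (P : probability Omega R) (B I : nat).

(** The sets of size [I] avoiding [i] number ['C(B.-1, I)], so Pascal's rule leaves ['C(B.-1, I.-1)]
    containing it. The ratio [I / B] is multiplied out to stay in [nat]. *)
Lemma card_draws_mem (i : 'I_B) : (0 < I)%N ->
  (B * #|[set S : {set 'I_B} | (i \in S) && (#|S| == I)]%SET| = I * 'C(B, I))%N.
Proof.
move=> I0; have B0 : (0 < B)%N by case: B i => [[]|].
suff -> : #|[set S : {set 'I_B} | (i \in S) && (#|S| == I)]%SET| = 'C(B.-1, I.-1).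
  by case: I I0 => // I' _; case: B B0 => // B' _; rewrite /= mul_bin_diag.
have := cardsID [set S : {set 'I_B} | i \in S]%SET [set S : {set 'I_B} | #|S| == I]%SET.
rewrite card_draws card_ord.
have -> : ([set S : {set 'I_B} | #|S| == I] :\: [set S : {set 'I_B} | i \in S])%SET =
    [set S : {set 'I_B} | S \subset [set~ i] & #|S| == I]%SET.
  by apply/setP => S; rewrite !inE finset.subsetC finset.sub1set inE.
rewrite cards_draws cardsC1 card_ord finset.setIC.
have -> : ([set S : {set 'I_B} | i \in S] :&: [set S : {set 'I_B} | #|S| == I])%SET =
    [set S : {set 'I_B} | (i \in S) && (#|S| == I)]%SET
  by apply/setP => S; rewrite !inE.
case: I I0 => // I' _; case: B i B0 => // B' i _; rewrite binS /= addnC.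
by move/addnI.
Qed.

Lemma measure_sampled (Is : Omega -> {set 'I_B}) (i : 'I_B) : (0 < I <= B)%N ->
  (forall S, measurable [set w | Is w = S]) ->
  (forall S, P [set w | Is w = S] =
     (if #|S| == I then ('C(B, I))%:R^-1 else 0)%:E) ->
  P [set w | i \in Is w] = (I%:R / B%:R)%:E.
Proof.
move=> /andP[I0 IB] mIs PIs.
pose s := [seq S : {set 'I_B} <- index_enum _ | i \in S].
have -> : [set w | i \in Is w] = \bigcup_(S in [set` s]) [set w | Is w = S].
  apply/seteqP; split => [w /= iw|w [S]].
    by exists (Is w) => //; rewrite /= mem_filter iw mem_index_enum.
  by rewrite /= mem_filter => /andP[iS _] ->.
have tIs : trivIset [set` s] (fun S => [set w | Is w = S]).
  apply/trivIsetP => S S' _ _ /eqP SS'; apply/seteqP; split => // w [/= e1 e2].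
  by case: SS'; rewrite -e1 -e2.
rewrite (measure_fin_bigcup P (finite_seq s) tIs) //.
rewrite -fsbig_seq ?filter_uniq ?index_enum_uniq // big_filter.
rewrite (eq_bigr _ (fun S _ => PIs S)) sumEFin -big_mkcondr /= sumr_const.
congr (_%:E).
have B0 : B%:R != 0 :> R by rewrite pnatr_eq0 -lt0n (leq_trans I0).
have C0 : 'C(B, I)%:R != 0 :> R by rewrite pnatr_eq0 -lt0n bin_gt0.
have := card_draws_mem i I0; rewrite cardsE => /(congr1 (fun k => k%:R : R)).
rewrite !natrM => BN; rewrite -[LHS]mulr_natl.
apply: (mulIf B0); apply: (mulIf C0); rewrite divfK // -BN; field.
exact: C0.
Qed.

End Sampling.

Section StepMeasurable.
Context {R : realType} {n B L : nat} {d1 : measure_display}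
  {T : measurableType d1}.
Variables (blk : 'I_n -> 'I_B) (f : 'rV[R]_n -> T -> R).
Hypothesis mf : forall x, measurable_fun setT (f x).
Hypothesis df : forall th x, differentiable (f^~ th) x.

Lemma measurable_step {d : measure_display} {Omega : measurableType d}
    (gamma : R) (X : Omega -> 'rV[R]_n)
    (S : Omega -> {set 'I_B}) (batch : 'I_B -> 'I_L -> Omega -> T) :
  (forall j, measurable_fun setT (fun w => X w 0 j)) ->
  (forall i, measurable [set w | i \in S w]) ->
  (forall i l, measurable_fun setT (batch i l)) ->
  forall j, measurable_fun setT (fun w =>
    (X w - gamma *: block_direction blk f (X w) (S w) (fun i l => batch i l w)) 0 j).
Proof.
move=> mX mS mb j.
under eq_fun do rewrite !mxE.
apply: measurable_funB => //; apply: measurable_funM => //.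
apply: measurable_fun_ifT => //.
  apply: (measurable_fun_bool true); rewrite setTI.
  rewrite (_ : _ @^-1` _ = [set w | blk j \in S w]) //.
apply: measurable_funM => //; apply: measurable_sum => l.
apply: (measurable_grad (g := fun x w => f x (batch (blk j) l w))) => // x.
exact: measurableT_comp.
Qed.

(** The iterate is read on one factor and the draws on the other: this is the joint measurability
    that Tonelli requires when past and present are separated. *)
Lemma measurable_step_prod {d2 d3 : measure_display} {T1 : measurableType d2}
    {T2 : measurableType d3} (gamma : R) (X : T1 -> 'rV[R]_n)
    (S : T2 -> {set 'I_B}) (batch : 'I_B -> 'I_L -> T2 -> T) :
  (forall j, measurable_fun setT (fun z => X z 0 j)) ->
  (forall i, measurable [set z | i \in S z]) ->
  (forall i l, measurable_fun setT (batch i l)) ->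
  forall j, measurable_fun setT (fun z : T1 * T2 =>
    (X z.1 - gamma *:
      block_direction blk f (X z.1) (S z.2) (fun i l => batch i l z.2)) 0 j).
Proof.
move=> mX mS mb.
apply: (@measurable_step _ _ gamma (fun z : T1 * T2 => X z.1) (fun z => S z.2)
  (fun i l z => batch i l z.2)).
- by move=> i; exact: (measurableT_comp (mX i) measurable_fst).
- move=> i; rewrite -[X in measurable X]setTI.
  have h : measurable (setT `&` snd @^-1` [set z | i \in S z] : set (T1 * T2)).
    exact: (@measurable_snd _ _ T1 T2 measurableT _ (mS i)).
  exact: h.
- by move=> i l; exact: (measurableT_comp (mb i l) measurable_snd).
Qed.

End StepMeasurable.

Section TraceSigmaAlgebra.
Context {V : ptopologicalType} (D : set V).

(* The sets that agree on [D] with a Borel set: [D] need not be Borel, yet this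
   is a sigma-algebra on the whole of [V]. *)
Definition trace_borel : set (set V) :=
  image_set_system D id (preimage_set_system D id (@borel V)).

Lemma sigma_algebra_trace_borel : sigma_algebra setT trace_borel.
Proof.
apply: sigma_algebra_image; apply: sigma_algebra_preimage.
exact: smallest_sigma_algebra.
Qed.

Local Notation V_D := (g_sigma_algebraType trace_borel).

(** One Borel set [C'] serves every [D]-valued map [Y], which is what allows the laws of two such
    maps to be compared. *)
Lemma trace_borelP {U : Type} (C : set V) : (measurable : set (set V_D)) C ->
  exists2 C', borel C' &
    forall Y : U -> V, (forall w, D (Y w)) -> Y @^-1` C = Y @^-1` C'.
Proof.
rewrite /measurable /= (sigma_algebra_id sigma_algebra_trace_borel).
move=> [C' bC' /seteqP[CC' C'C]]; exists C' => // Y DY.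
apply/seteqP; split => w CYw.
  by have [] := C'C (Y w) (conj (DY w) CYw).
by have [] := CC' (Y w) (conj (DY w) CYw).
Qed.

(** Membership in [trace_borel] is tested inside [D] alone, so [g'] may take any values off [D], for
    instance zero. *)
Lemma measurable_trace_borel {R : realType} (g g' : V -> R) :
  borel_on D g -> {in D, g =1 g'} -> measurable_fun (setT : set V_D) g'.
Proof.
move=> bg gg' _ U mU; rewrite setTI.
rewrite /measurable /= (sigma_algebra_id sigma_algebra_trace_borel).
have [|C bC CE] := bg (D `&` g @^-1` U); first by exists U.
exists C => //; rewrite -[LHS]/(D `&` C) -[RHS]/(D `&` g' @^-1` U).
rewrite [LHS]CE; apply/seteqP; split => v [Dv]; rewrite /preimage /= gg' ?inE //.
Qed.

Lemma sigma_of_preimage {d : measure_display} {Omega : measurableType d}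
    (Y : Omega -> V) (C : set V_D) :
  (forall w, D (Y w)) -> measurable C -> sigma_of Y (Y @^-1` C).
Proof.
move=> DY /(@trace_borelP Omega)[C' bC' CC']; exists C' => //.
by rewrite setTI CC'.
Qed.

Lemma same_law_trace_borel {d : measure_display} {Omega : measurableType d}
    {R : realType} (P : probability Omega R) (X Y : Omega -> V) (C : set V_D) :
  (forall w, D (X w)) -> (forall w, D (Y w)) -> same_law P X Y ->
  measurable C -> P (X @^-1` C) = P (Y @^-1` C).
Proof.
by move=> DX DY XY /(@trace_borelP Omega)[C' bC' CC']; rewrite !CC' // XY.
Qed.

End TraceSigmaAlgebra.

(** * The second moment given the current iterate *)

Section SecondMoment.
Local Open Scope ereal_scope.
Context {R : realType} {n : nat} {d d1 : measure_display}
  {Omega : measurableType d} {T : measurableType d1}.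
Variables (P : probability Omega R) (f : 'rV[R]_n -> T -> R).
Variables (theta : Omega -> T) (X : Omega -> 'rV[R]_n) (K : R).
Hypothesis mf : forall x, measurable_fun setT (f x).
Hypothesis df : forall th x, differentiable (f^~ th) x.
Hypothesis mtheta : measurable_fun setT theta.
Hypothesis mX : forall j, measurable_fun setT (fun w => X w 0%R j).
Hypothesis X_theta : forall A C, sigma_of X A -> measurable C ->
  P (A `&` theta @^-1` C) = P A * P (theta @^-1` C).

Local Notation Omega_X := (g_sigma_algebraType (sigma_of X)).

Let sigma_ofX : sigma_algebra setT (sigma_of X).
Proof. exact/sigma_algebra_preimage/smallest_sigma_algebra. Qed.

Let mOmega_X (A : set Omega) : (measurable : set (set Omega_X)) A = sigma_of X A.
Proof. by rewrite /measurable /= (sigma_algebra_id sigma_ofX). Qed.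

Let mXX j : measurable_fun (setT : set Omega_X) (fun w => X w 0%R j).
Proof.
apply: (measurability _ (RGenOpens.measurableE R)) => _ [_ [a [b ->]] <-].
rewrite mOmega_X; exists ((fun x : 'rV[R]_n => x 0%R j) @^-1` `]a, b[%classic) => //.
apply: sub_sigma_algebra; apply: open_comp; last exact: interval_open.
by move=> x _; exact: coord_continuous.
Qed.

Let q (z : Omega_X * T) : R := (enorm (grad (f^~ z.2) (X z.1)) ^+ 2)%R.

Let mq : measurable_fun setT q.
Proof.
rewrite /q; under eq_fun do rewrite sqr_enormE.
apply: measurable_sum => j; apply: measurable_funX.
apply: (measurable_grad (X := fun z : Omega_X * T => X z.1)
   (g := fun x (z : Omega_X * T) => f x z.2)) => // [i|x].
  exact: (measurableT_comp (mXX i) measurable_fst).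
exact: (measurableT_comp (mf x) measurable_snd).
Qed.

Let mid : measurable_fun setT (id : Omega -> Omega_X).
Proof.
move=> _ A; rewrite mOmega_X setTI; exact: borel_random_coord.
Qed.

Lemma second_moment_ae (Y : Omega -> \bar R) :
  is_cond_exp P (sigma_of X)
    (fun w => (enorm (grad (f^~ (theta w)) (X w)) ^+ 2)%:E) Y ->
  {ae P, forall w, Y w <= K%:E} ->
  {ae P, forall w,
    \int[P]_w' (enorm (grad (f^~ (theta w')) (X w)) ^+ 2)%:E <= K%:E}.
Proof.
move=> [YX YE] YK.
pose h w := \int[P]_w' (enorm (grad (f^~ (theta w')) (X w)) ^+ 2)%:E.
have hE w : h w = \int[P]_w' (EFin \o q) ((w : Omega_X), theta w') by [].
have q0 z : 0 <= (EFin \o q) z by rewrite lee_fin sqr_ge0.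
have mqE : measurable_fun setT (EFin \o q) by exact/measurable_EFinP.
have mh : measurable_fun (setT : set Omega_X) h.
  exact: (measurable_integral_snd P mtheta mqE q0).
have mZ : measurable_fun setT (fun w => (q (w, theta w))%:E).
  exact: (measurableT_comp mqE (measurable_fun_pair mid mtheta)).
have mY : measurable_fun setT Y.
  move=> _ U mU; apply: (borel_random_coord mX); apply: YX.
  by exists U.
have mhO : measurable_fun (setT : set Omega) h by exact: (measurableT_comp mh mid).
have null (e : R) : (0 < e)%R -> P [set w | (K + e)%:E <= h w] = 0.
  move=> e0; set A := [set w | _].
  have XA : sigma_of X A.
    rewrite -mOmega_X (_ : A = setT `&` h @^-1` `[(K + e)%:E, +oo[).
      by apply: mh => //; exact: emeasurable_itv.
    by rewrite setTI; apply/seteqP; split => w; rewrite /A /= in_itv /= andbT.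
  have mA : measurable A by exact: (borel_random_coord mX).
  have hA : \int[P]_(w in A) h w = \int[P]_(w in A) Y w.
    rewrite YE // integral_mkcond [RHS]integral_mkcond.
    pose phi (z : Omega_X * T) := if z.1 \in A then (q z)%:E else 0.
    have mphi : measurable_fun setT phi.
      apply: measurable_fun_ifT => //.
      apply: (measurable_fun_bool true); rewrite setTI.
      rewrite (_ : _ @^-1` _ = fst @^-1` A).
        rewrite -[X in measurable X]setTI.
        by apply: measurable_fst => //; rewrite mOmega_X.
      by apply/seteqP; split => z /=; [move/set_mem|move/mem_set].
    have phi0 z : 0 <= phi z by rewrite /phi; case: ifP => // _; exact: q0.
    transitivity (\int[P]_w \int[P]_w' phi ((w : Omega_X), theta w')).
      apply: eq_integral => w _; rewrite patchE /phi /=.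
      by case: ifP => // _; rewrite integral0.
    rewrite -(integral_independent (X := id : Omega -> Omega_X) mid mtheta _ mphi phi0).
      by apply: eq_integral => w _; rewrite patchE.
    by move=> B C; rewrite mOmega_X => XB mC; exact: X_theta.
  have h1 : \int[P]_(w in A) h w <= K%:E * P A.
    by rewrite hA; exact: ae_le_integral_cst.
  have h2 : (K + e)%:E * P A <= \int[P]_(w in A) h w.
    rewrite -integral_cst //; apply: le_measurable_integral => //.
    exact: measurable_funTS.
  have := le_trans h2 h1.
  rewrite -(fineK (fin_num_measure P A mA)) -!EFinM lee_fin mulrDl gerDl.
  rewrite pmulr_rle0 // => PA; congr _%:E; apply/eqP.
  by rewrite eq_le PA fine_ge0.
have negl k : P.-negligible [set w | (K + k.+1%:R^-1)%:E <= h w].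
  exists [set w | (K + k.+1%:R^-1)%:E <= h w]; split => //; last exact: null.
  by rewrite -[X in measurable X]setTI; exact: emeasurable_fun_c_infty.
apply: negligibleS (negligible_bigcup negl).
move=> w /= /negP; rewrite -ltNge -/(h w).
have : 0 <= h w by apply: integral_ge0 => w' _; rewrite lee_fin sqr_ge0.
case hw : (h w) => [s| |] // _; last by exists 0%N => //=; rewrite hw leey.
by rewrite lte_fin => /ltr_add_invr[k /ltW Kk]; exists k => //=; rewrite hw lee_fin.
Qed.

End SecondMoment.

(** * Recursion along the algorithm *)

Section Process.
Context {R : realType} {n B L : nat} {d d1 : measure_display}
  {Omega : measurableType d} {T : measurableType d1}.
Variables (P : probability Omega R) (blk : 'I_n -> 'I_B).
Variables (f : 'rV[R]_n -> T -> R) (F : 'rV[R]_n -> R).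
Variables (theta : Omega -> T) (Is : nat -> Omega -> {set 'I_B})
  (xi : nat -> 'I_B -> 'I_L -> Omega -> T).
Variables (gamma r m M K : R) (x0 y : 'rV[R]_n) (x : nat -> Omega -> 'rV[R]_n).
(* Generators of the sigma-algebras of the draws before step [t] and at step [t]. *)
Variables (past now : nat -> set (set Omega)).
Hypothesis n0 : (0 < n)%N.
Hypothesis L0 : (0 < L)%N.
Hypothesis mf : forall x, measurable_fun setT (f x).
Hypothesis df : forall th x, differentiable (f^~ th) x.
Hypothesis dF : forall x, differentiable F x.
Hypothesis mtheta : measurable_fun setT theta.
Hypothesis x_0 : forall w, x 0%N w = x0.
Hypothesis x_S : forall t w, x t.+1 w =
  x t w - gamma *: block_direction blk f (x t w) (Is t w) (fun i l => xi t i l w).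
Hypothesis past_measurable : forall t, past t `<=` measurable.
Hypothesis now_measurable : forall t, now t `<=` measurable.
Hypothesis past_mono : forall t, past t `<=` past t.+1.
Hypothesis now_past : forall t, now t `<=` past t.+1.
Hypothesis past_now : forall t, independent2 P <<s past t >> <<s now t >>.
Hypothesis Is_now : forall t i, <<s now t >> [set w | i \in Is t w].
Hypothesis xi_now : forall t i l C, measurable C -> <<s now t >> (xi t i l @^-1` C).
Hypothesis PIs : forall t i, P [set w | i \in Is t w] = r%:E.
Hypothesis xi_law : forall t i l C, measurable C ->
  P (theta @^-1` C) = P (xi t i l @^-1` C).
Hypothesis xi_Is : forall t i l C, measurable C ->
  P ([set w | i \in Is t w] `&` xi t i l @^-1` C) =
  (P [set w | i \in Is t w] * P (xi t i l @^-1` C))%E.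
Hypothesis unbiased : forall x j,
  'E_P[fun w => grad (f^~ (theta w)) x 0%R j]%E = (grad F x 0 j)%:E.
Hypothesis second_moment : forall t, {ae P, forall w,
  (\int[P]_w' (enorm (grad (f^~ (theta w')) (x t w)) ^+ 2)%:E <= K%:E)%E}.
Hypothesis Fmin : forall z, F y <= F z.
Hypothesis lipF : lipschitz_gradient M F.
Hypothesis m0 : 0 < m.
Hypothesis convF : strongly_convex m F.
Hypothesis gamma0 : 0 < gamma.
Hypothesis r0 : 0 < r.

Local Notation Past t := (g_sigma_algebraType (past t)).
Local Notation Now t := (g_sigma_algebraType (now t)).

Let sigma_sub (G : set (set Omega)) : G `<=` measurable -> <<s G >> `<=` measurable.
Proof. by move=> mG; apply: smallest_sub => //; exact: sigma_algebra_measurable. Qed.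

Let sigma_past_mono t : <<s past t >> `<=` <<s past t.+1 >>.
Proof. by apply: sub_sigma_algebra2; exact: past_mono. Qed.

Let sigma_now_past t : <<s now t >> `<=` <<s past t.+1 >>.
Proof. by apply: sub_sigma_algebra2; exact: now_past. Qed.

Let mIs t i : measurable [set w | i \in Is t w].
Proof. exact: (sigma_sub (@now_measurable t)). Qed.

Let mxi t i l : measurable_fun setT (xi t i l).
Proof.
move=> _ C mC; rewrite setTI; apply: (sigma_sub (@now_measurable t)).
exact: xi_now.
Qed.

Lemma x_past t j : measurable_fun (setT : set (Past t)) (fun w => x t w 0 j).
Proof.
elim: t j => [|t IH] j.
  by under eq_fun do rewrite x_0; exact: measurable_cst.
under eq_fun do rewrite x_S.
apply: (@measurable_step _ _ _ _ _ _ blk f mf df _ (Past t.+1)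
  gamma (x t) (Is t) (xi t)).
- by move=> i _ U mU; apply: sigma_past_mono; exact: IH.
- by move=> i; apply: sigma_now_past; exact: Is_now.
- by move=> i l _ C mC; rewrite setTI; apply: sigma_now_past; exact: xi_now.
Qed.

Lemma x_measurable t j : measurable_fun setT (fun w => x t w 0 j).
Proof. by move=> _ U mU; apply: (sigma_sub (@past_measurable t)); exact: x_past. Qed.

Let mF_comp d2 (T2 : measurableType d2) (X : T2 -> 'rV[R]_n) :
  (forall j, measurable_fun setT (fun w => X w 0 j)) ->
  measurable_fun setT (fun w => F (X w)).
Proof.
move=> mX; apply: (measurable_caratheodory (g := fun z _ => F z)) => //.
by move=> _ z; exact: differentiable_continuous.
Qed.

Definition gap t w : R := F (x t w) - F y.

Lemma gap_ge0 t w : 0 <= gap t w.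
Proof. by rewrite subr_ge0. Qed.

Lemma measurable_gap t : measurable_fun setT (gap t).
Proof. by apply: measurable_funB => //; exact: mF_comp (@x_measurable t). Qed.

Lemma gap_past t (s : R) : <<s past t >> [set w | s < gap t w].
Proof.
have mg : measurable_fun (setT : set (Past t)) (gap t).
  by apply: measurable_funB => //; apply: mF_comp => j; exact: x_past.
have := mg measurableT `]s, +oo[%classic (measurable_itv _); rewrite setTI.
by congr (<<s _ >> _); apply/seteqP; split => w; rewrite /= in_itv /= andbT.
Qed.

Local Notation rho := (2 * m * r * gamma).
Local Notation kappa := (M * gamma ^+ 2 / 2 * r * K).

Let r_ge0 : 0 <= r. Proof. exact: ltW. Qed.

Let M_ge0 : 0 <= M.
Proof. exact: lipschitz_gradient_ge0 lipF. Qed.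

(** An almost sure event of a probability is nonempty, and at any point of it [K] dominates the
    integral of a square. *)
Let K_ge0 : 0 <= K.
Proof.
have PT : (0 < P setT)%E by rewrite probability_setT lte_fin.
have /(@filter_ex _ _ (ae_properfilter_algebraOfSetsType PT))[w Kw] := second_moment 0.
rewrite -lee_fin; apply: le_trans Kw; apply: integral_ge0 => w' _.
by rewrite lee_fin sqr_ge0.
Qed.

Let kappa_ge0 : 0 <= kappa.
Proof. by rewrite mulr_ge0 // mulr_ge0 // divr_ge0 // mulr_ge0 // sqr_ge0. Qed.

Local Open Scope ereal_scope.

(** Stands for the conditional expectation of the next gap given the past: the iterate is frozen at
    [z] while the draws of step [t] are averaged. *)
Let step_integral t (z : Omega) : \bar R := \int[P]_w
  (F (x t z - gamma *:
    block_direction blk f (x t z) (Is t w) (fun i l => xi t i l w)) - F y)%:E.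

Let step_integral_le t : {ae P, forall w,
  step_integral t w + (rho * gap t w)%:E <= (gap t w + kappa)%:E}.
Proof.
apply: filterS (second_moment t) => w Kw.
have mstep : measurable_fun setT (fun w' => F (x t w -
    gamma *: block_direction blk f (x t w) (Is t w') (fun i l => xi t i l w'))).
  apply: mF_comp => j.
  exact: (measurable_step blk mf df gamma (X := fun=> x t w)).
have := expected_descent n0 L0 mf df dF mtheta (mxi t) (mIs t) (PIs t)
  (@xi_law t) (@xi_Is t) (unbiased (x t w)) Kw Fmin lipF mstep.
move=> h; apply: le_trans (leeD2r _ h) _.
rewrite -EFinD lee_fin -/(gap t w).
have := polyak_lojasiewicz (x t w) y m0 convF; rewrite -/(gap t w) => pl.
have : (gamma * r * (2 * m * gap t w) <= gamma * r * enorm (grad F (x t w)) ^+ 2)%R.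
  by rewrite ler_wpM2l // mulr_ge0 // ltW.
lra.
Qed.

Lemma integral_gap_descent t A : <<s past t >> A ->
  \int[P]_(w in A) (gap t.+1 w)%:E + rho%:E * \int[P]_(w in A) (gap t w)%:E
  <= \int[P]_(w in A) (gap t w)%:E + kappa%:E * P A.
Proof.
move=> pA; have mA : measurable A by exact: (sigma_sub (@past_measurable t)).
have mg s : measurable_fun A (fun w => (gap s w)%:E).
  by apply/measurable_EFinP; apply: measurable_funTS; exact: measurable_gap.
have rho0 : (0 <= rho)%R by rewrite !mulr_ge0 // ltW.
(* The update is placed on two copies of [Omega], one with the past and one with the current
   sigma-algebra. On the diagonal it is [x t.+1], and [past_now] lets Tonelli separate the
   copies. *)
pose X (z : Past t * Now t) := (x t z.1 - gamma *:
  block_direction blk f (x t z.1) (Is t z.2) (fun i l => xi t i l z.2))%R.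
have mX j : measurable_fun setT (fun z => X z 0%R j).
  have mxi' i l : measurable_fun (setT : set (Now t)) (xi t i l).
    by move=> _ C mC; rewrite setTI; exact: xi_now.
  exact: (@measurable_step_prod _ _ _ _ _ _ blk f mf df _ _ (Past t) (Now t)
    gamma (x t) (Is t) (xi t) (@x_past t) (@Is_now t) mxi').
pose phi (z : Past t * Now t) : \bar R := if z.1 \in A then (F (X z) - F y)%:E else 0.
have mA' : measurable (A : set (Past t)) by [].
have mphi1 : measurable_fun setT (fun z => (F (X z) - F y)%:E).
  by apply/measurable_EFinP; apply: measurable_funB => //; exact: mF_comp.
have phi10 z : 0 <= (F (X z) - F y)%:E by rewrite lee_fin subr_ge0.
have mphi : measurable_fun setT phi.
  apply: measurable_fun_ifT => //.
    apply: (measurable_fun_bool true); rewrite setTI.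
    rewrite (_ : _ @^-1` _ = fst @^-1` A).
      by rewrite -[X in measurable X]setTI; exact: measurable_fst.
    by apply/seteqP; split => z /=; [move/set_mem|move/mem_set].
have phi0 z : 0 <= phi z.
  by rewrite /phi; case: ifP => // _; rewrite lee_fin subr_ge0.
have midP : measurable_fun setT (id : Omega -> Past t).
  by move=> _ C pC; rewrite setTI; exact: (sigma_sub (@past_measurable t)).
have midN : measurable_fun setT (id : Omega -> Now t).
  by move=> _ C pC; rewrite setTI; exact: (sigma_sub (@now_measurable t)).
have step_ge0 w : 0 <= step_integral t w.
  by apply: integral_ge0 => w' _; rewrite lee_fin subr_ge0.
have -> : \int[P]_(w in A) (gap t.+1 w)%:E = \int[P]_(w in A) step_integral t w.
  rewrite integral_mkcond [RHS]integral_mkcond.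
  transitivity (\int[P]_w phi ((w : Past t), (w : Now t))).
    by apply: eq_integral => w _; rewrite patchE /gap x_S.
  rewrite (integral_independent (X := id : Omega -> Past t) (Y := id : Omega -> Now t)
    midP midN (@past_now t) mphi phi0).
  apply: eq_integral => w _; rewrite patchE /phi /=.
  by case: ifP => // _; rewrite integral0.
have mstep : measurable_fun A (step_integral t).
  apply: measurable_funTS; have := measurable_integral_snd P midN mphi1 phi10.
  by move=> h _ U mU; apply: (sigma_sub (@past_measurable t)); exact: h.
rewrite -ge0_integralZl_EFin //; last by move=> w _; rewrite lee_fin gap_ge0.
have mrg : measurable_fun A (fun w => rho%:E * (gap t w)%:E).
  by apply: measurable_funeM.
rewrite -ge0_integralD //; last first.
  by move=> w _; rewrite -EFinM lee_fin mulr_ge0 // gap_ge0.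
have gap0 w : A w -> 0 <= (gap t w)%:E by rewrite lee_fin gap_ge0.
have kappa0 w : A w -> 0 <= cst kappa%:E w by rewrite lee_fin kappa_ge0.
rewrite -[kappa%:E * _]integral_cst // -(ge0_integralD P mA gap0 (mg t) kappa0) //.
apply: ae_ge0_le_integral => //.
- by move=> w _; rewrite adde_ge0 // -EFinM lee_fin mulr_ge0 // gap_ge0.
- by apply: emeasurable_funD.
- by move=> w _; rewrite adde_ge0 // lee_fin ?gap_ge0 ?kappa_ge0.
- by apply: emeasurable_funD.
- by apply: filterS (step_integral_le t) => w h _; rewrite -EFinM -EFinD.
Qed.

(** The initial gap is constant, and the descent inequality over the sure event passes finiteness on
    from [t] to [t.+1]. *)
Let integral_gap_fin t A : measurable A -> \int[P]_(w in A) (gap t w)%:E \is a fin_num.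
Proof.
move=> mA; have g0 s (D : set Omega) : 0 <= \int[P]_(w in D) (gap s w)%:E.
  by apply: integral_ge0 => w _; rewrite lee_fin gap_ge0.
have mg s : measurable_fun setT (fun w => (gap s w)%:E).
  by apply/measurable_EFinP; exact: measurable_gap.
suff fin : \int[P]_w (gap t w)%:E < +oo.
  rewrite ge0_fin_numE //; apply: le_lt_trans fin.
  by apply: ge0_subset_integral => // w _; rewrite lee_fin gap_ge0.
elim: t => [|t IH].
  under eq_integral => w _ do rewrite /gap x_0.
  by rewrite integral_cst // [X in _ * X]probability_setT mule1 ltry.
have pT : <<s past t >> setT by exact: (@measurableT _ (Past t)).
have := integral_gap_descent pT; rewrite probability_setT mule1 => h.
apply: le_lt_trans (leeDl _ _) (le_lt_trans h _).
  by rewrite mule_ge0 // lee_fin !mulr_ge0 // ltW.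
by rewrite lte_add_pinfty // ltry.
Qed.

Let mean t A : R := fine (\int[P]_(w in A) (gap t w)%:E).
Let pr A : R := fine (P A).

Let meanE t A : measurable A -> \int[P]_(w in A) (gap t w)%:E = (mean t A)%:E.
Proof. by move=> mA; rewrite fineK // integral_gap_fin. Qed.

Local Open Scope ring_scope.
Local Notation c := (gamma * M * K / (4 * m)).

Let c_ge0 : 0 <= c.
Proof. by rewrite divr_ge0 ?mulr_ge0 // ltW. Qed.

Let mean_descent t A : <<s past t >> A ->
  mean t.+1 A + rho * mean t A <= mean t A + rho * c * pr A.
Proof.
move=> pA; have mA : measurable A by exact: (sigma_sub (@past_measurable t)).
(* This identity makes [c] the fixed point of the map sending [u] to [(1 - rho) * u + kappa]. *)
have kE : kappa = rho * c by field; rewrite gt_eqF.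
have := integral_gap_descent pA; rewrite !meanE // -[P A]fineK ?fin_num_measure //.
by rewrite -!EFinM -!EFinD lee_fin kE.
Qed.

Lemma integral_gap_le t : rho < 1 ->
  (\int[P]_w (gap t w)%:E <= ((1 - rho) ^+ t * (F x0 - F y) + c)%:E)%E.
Proof.
move=> rho1; rewrite meanE // lee_fin; elim: t => [|t IH].
  rewrite expr0 mul1r -lee_fin -meanE //.
  under eq_integral => w _ do rewrite /gap x_0.
  by rewrite integral_cst // [X in (_ * X)%E]probability_setT mule1 lee_fin lerDl.
have pT : <<s past t >> setT by exact: (@measurableT _ (Past t)).
have := mean_descent pT; rewrite /pr probability_setT mulr1 => h.
(* Since [1 - rho] is nonnegative, the induction hypothesis may be multiplied by it;
   [(1 - rho) * c + rho * c = c] reproduces the constant. *)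
rewrite exprS -mulrA; have rho1' : 0 <= 1 - rho by rewrite subr_ge0 ltW.
have := ler_wpM2l rho1' IH; lra.
Qed.

(** The window is finite so that the event is known at time [t + k], endpoint included: [x (t + k)]
    uses only draws of earlier steps. The descent inequality can then be integrated over it. *)
Let low (e : R) (t k : nat) : set Omega :=
  \bigcap_(i in [set i | (i <= k)%N]) [set w | c + e < gap (t + i) w].

Let lowS e t k : low e t k.+1 = low e t k `&` [set w | c + e < gap (t + k.+1) w].
Proof.
apply/seteqP; split => w.
  move=> h; split; last exact: (h k.+1 (leqnn _)).
  by move=> i /= ik; apply: h => /=; exact: leqW.
by move=> [h1 h2] i /=; rewrite leq_eqVlt => /orP[/eqP->//|]; exact: h1.
Qed.

Let low_past e t k : <<s past (t + k) >> (low e t k).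
Proof.
elim: k => [|k IH].
  rewrite (_ : low _ _ _ = [set w | c + e < gap t w]).
    by rewrite addn0; exact: gap_past.
  apply/seteqP; split => w; first by move/(_ 0%N isT); rewrite addn0.
  by move=> h i /=; rewrite leqn0 => /eqP ->; rewrite addn0.
rewrite lowS; apply: (@measurableI _ (Past (t + k.+1))); last exact: gap_past.
by rewrite addnS; exact: sigma_past_mono.
Qed.

(* On [low e t k] the gap exceeds [c + e] up to time [t + k], so each further
   step loses at least [rho * e] times the probability of staying there. *)
Let always_low_null e t : 0 < e -> P (\bigcap_k low e t k) = 0%E.
Proof.
move=> e0; set A := \bigcap_k _.
have ml k : measurable (low e t k).
  exact: (sigma_sub (@past_measurable (t + k)) (@low_past e t k)).
have mA : measurable A by exact: bigcapT_measurable.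
have rho0 : 0 < rho by rewrite !mulr_gt0.
have prA k : pr A <= pr (low e t k).
  rewrite fine_le ?fin_num_measure //; apply: le_measure; rewrite ?inE //.
  exact: bigcap_inf.
(* Every step loses at least the amount [rho * e * pr A], which does not depend on [k]. If [pr A]
   were positive, enough steps would exhaust the finite initial mean. *)
have main k : mean (t + k) (low e t k) + k%:R * (rho * e * pr A) <= mean t (low e t 0).
  elim: k => [|k IH]; first by rewrite mul0r addr0 addn0.
  apply: le_trans IH.
  have h1 : mean (t + k.+1) (low e t k.+1) <= mean (t + k).+1 (low e t k).
    rewrite addnS -lee_fin -!meanE //; apply: ge0_subset_integral => //.
    - by apply/measurable_EFinP; apply: measurable_funTS; exact: measurable_gap.
    - by move=> w _; rewrite lee_fin gap_ge0.
    - by rewrite lowS; exact: subIsetl.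
  have h2 : (c + e) * pr (low e t k) <= mean (t + k) (low e t k).
    rewrite -lee_fin -meanE // EFinM fineK ?fin_num_measure // -integral_cst //.
    apply: ge0_le_integral => //.
    - by move=> w _; rewrite lee_fin addr_ge0 // ltW.
    - by apply/measurable_EFinP; apply: measurable_funTS; exact: measurable_gap.
    - by move=> w lw; rewrite lee_fin ltW //; exact: (lw k (leqnn k)).
  have h3 := mean_descent (@low_past e t k).
  have h4 : rho * e * pr A <= rho * e * pr (low e t k).
    by rewrite ler_wpM2l // mulr_ge0 // ltW.
  have h5 := ler_wpM2l (ltW rho0) h2.
  rewrite -natr1; lra.
have pA0 : pr A = 0.
  apply/eqP; rewrite eq_le fine_ge0 // andbT leNgt; apply/negP => pA0.
  have q0 : 0 < rho * e * pr A by rewrite !mulr_gt0.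
  have [k hk] : exists k : nat, mean t (low e t 0) < k%:R * (rho * e * pr A).
    exists (Num.bound (mean t (low e t 0) / (rho * e * pr A))).
    rewrite -ltr_pdivrMr //; apply: archi_boundP.
    rewrite divr_ge0 ?(ltW q0) // fine_ge0 //; apply: integral_ge0 => w _.
    by rewrite lee_fin gap_ge0.
  have := main k; rewrite leNgt => /negP; apply; apply: lt_le_trans hk _.
  rewrite lerDr /mean fine_ge0 //; apply: integral_ge0 => w _.
  by rewrite lee_fin gap_ge0.
by rewrite -[LHS]fineK ?fin_num_measure //; congr _%:E.
Qed.

(** Off a countable union of null sets, every tail contains, for each [k], a gap of at most
    [c + 1 / (k + 1)]. So all tail infima are at most [c], and the limit inferior is their
    supremum. *)
Lemma liminf_gap_le : {ae P, forall w,
  (limn_einf (fun t => (gap t w)%:E) <= c%:E)%E}.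
Proof.
have negl t : P.-negligible (\bigcup_k \bigcap_i low k.+1%:R^-1 t i).
  apply: negligible_bigcup => k; exists (\bigcap_i low k.+1%:R^-1 t i); split => //.
    apply: bigcapT_measurable => i.
    exact: (sigma_sub (@past_measurable (t + i)) (@low_past _ t i)).
  exact: always_low_null.
apply: negligibleS (negligible_bigcup negl) => w; apply: contra_notP => notlow.
move: notlow => /= notlow; rewrite limn_einf_lim.
have /cvg_lim -> // := @cvg_einfs_sup _ (fun t => (gap t w)%:E).
apply: ge_ereal_sup => _ [t _ <-].
apply/lee_addgt0Pr => e e0.
have [k _ /(_ k (leqnn k)) ke] := near_infty_natSinv_lt (PosNum e0).
have [i gi] : exists i, gap (t + i) w <= c + k.+1%:R^-1.
  apply: contra_notP notlow => noti; exists t => //; exists k => // i _ j _ /=.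
  by rewrite ltNge; apply/negP => gj; apply: noti; exists j.
apply: (@le_trans _ _ (gap (t + i) w)%:E).
  apply: ge_ereal_inf; exists (gap (t + i) w)%:E => //.
  by exists (t + i)%N => //=; exact: leq_addr.
by rewrite -EFinD lee_fin (le_trans gi) // lerD2l ltW.
Qed.

End Process.

(** * The draws of the algorithm *)

Section Draws.
Context {R : realType} {B L q : nat} {d : measure_display} {Omega : measurableType d}.
Variables (P : probability Omega R) (Is : nat -> Omega -> {set 'I_B}).
Variable xi : nat -> 'I_B -> 'I_L -> Omega -> 'rV[R]_q.

Definition draw_time (j : nat + nat * 'I_B * 'I_L) : nat :=
  match j with inl t => t | inr (t, _, _) => t end.

Lemma sigma_algebra_draws j : sigma_algebra setT (draws Is xi j).
Proof.
case: j => [t|[[t i] l]]; apply: sigma_algebra_preimage => //.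
exact: smallest_sigma_algebra.
Qed.

Lemma drawsT j : draws Is xi j setT.
Proof.
have [h0 hC _] := sigma_algebra_draws j.
by have := hC _ h0; rewrite setD0.
Qed.

Lemma setI_closed_draws j : setI_closed (draws Is xi j).
Proof.
case: j => [t|[[t i] l]] _ _ [C hC <-] [C' hC' <-]; exists (C `&` C').
- by [].
- by rewrite !setTI preimage_setI.
- exact: (@measurableI _ (g_sigma_algebraType (@open 'rV[R]_q))).
- by rewrite !setTI preimage_setI.
Qed.

Lemma draws_measurable j : (forall t S, measurable [set w | Is t w = S]) ->
  (forall t i l, borel_random (xi t i l)) -> draws Is xi j `<=` measurable.
Proof.
move=> mIs mxi; case: j => [t|[[t i] l]]; last exact: mxi.
move=> _ [C _ <-]; rewrite setTI.
rewrite (_ : _ @^-1` _ = \bigcup_(S in C) [set w | Is t w = S]).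
  by apply: fin_bigcup_measurable => //; exact: finite_finset.
by apply/seteqP; split => [w Cw|w [S CS /= wS]]; [exists (Is t w)|rewrite wS].
Qed.

End Draws.

(** [tagnat.sig1] returns the block of a flat coordinate, and [tagnat.sig2K] rebuilds the coordinate
    from its block and its position there. *)
Lemma rapsaS {R : realType} {B L q : nat} {Omega : Type} {pb : 'I_B -> nat}
    (f : 'rV[R]_(\sum_(b < B) pb b) -> 'rV[R]_q -> R) (gam : nat -> R) x0
    (Is : nat -> Omega -> {set 'I_B})
    (xi : nat -> 'I_B -> 'I_L -> Omega -> 'rV[R]_q) t w :
  rapsa f gam x0 Is xi t.+1 w = rapsa f gam x0 Is xi t w - gam t *:
    block_direction tagnat.sig1 f (rapsa f gam x0 Is xi t w) (Is t w)
      (fun i l => xi t i l w).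
Proof.
rewrite /=; set z := rapsa _ _ _ _ _ _ _.
apply/rowP => j; rewrite !mxE; case: ifP => jS.
  rewrite !mxE tagnat.sig2K summxE; congr (_ - _ * (_ * _)).
  by apply: eq_bigr => l _; rewrite !mxE tagnat.sig2K.
by rewrite mxE tagnat.sig2K mulr0 subr0.
Qed.
Theorem theorem5
  (R : realType)
  (* blocks, processors, mini-batch size, dimension of the parameter space *)
  (B I L q : nat) (pb : 'I_B -> nat)
  (hI : (0 < I <= B)%N) (hL : (0 < L)%N)
  (hp : (0 < \sum_(b < B) pb b)%N)
  (d : measure_display) (Omega : measurableType d) (P : probability Omega R)
  (* theta is a random variable with values in Theta *)
  (Theta : set 'rV[R]_q) (theta : Omega -> 'rV[R]_q)
  (htheta : borel_random theta) (hTheta : forall w, Theta (theta w))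
  (* instantaneous functions and their expectation *)
  (f : 'rV[R]_(\sum_(b < B) pb b) -> 'rV[R]_q -> R)
  (hfdiff : forall th, Theta th -> forall x, differentiable (f^~ th) x)
  (hfmeas : forall x, borel_on Theta (f x))
  (F : 'rV[R]_(\sum_(b < B) pb b) -> R)
  (hF : forall x, 'E_P[fun w => f x (theta w)]%E = (F x)%:E)
  (hFdiff : forall x, differentiable F x)
  (hunbiased : forall x j,
     'E_P[fun w => grad (f^~ (theta w)) x 0%R j]%E = (grad F x 0 j)%:E)
  (xstar : 'rV[R]_(\sum_(b < B) pb b)) (hxstar : forall x, F xstar <= F x)
  (* the random draws of the algorithm *)
  (Is : nat -> Omega -> {set 'I_B})
  (hIsmeas : forall t S, measurable [set w | Is t w = S])
  (hIsunif : forall t S, P [set w | Is t w = S] =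
     (if #|S| == I then ('C(B, I))%:R^-1 else 0)%:E)
  (xi : nat -> 'I_B -> 'I_L -> Omega -> 'rV[R]_q)
  (hxi : forall t i l, borel_random (xi t i l))
  (hxiTheta : forall t i l w, Theta (xi t i l w))
  (hxilaw : forall t i l, same_law P (xi t i l) theta)
  (hindep : mutually_independent P (draws Is xi))
  (* the iterates, with constant stepsize *)
  (gamma : R) (hgamma : 0 < gamma)
  (x0 : 'rV[R]_(\sum_(b < B) pb b))
  (x : nat -> Omega -> 'rV[R]_(\sum_(b < B) pb b))
  (hx : x = rapsa f (fun=> gamma) x0 Is xi)
  (m M K : R) (hm : 0 < m)
  (hconvex : strongly_convex m F)
  (hlip : lipschitz_gradient M F)
  (* theta is a fresh copy independent of x t; the conditional second moment
     of the stochastic gradient given x t is at most K *)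
  (hfresh : forall t, independent2 P (sigma_of theta) (sigma_of (x t)))
  (hK : forall t, exists2 Y : Omega -> \bar R,
     is_cond_exp P (sigma_of (x t))
       (fun w => (enorm (grad (f^~ (theta w)) (x t w)) ^+ 2)%:E) Y &
     {ae P, forall w, (Y w <= K%:E)%E}) :
  let r := I%:R / B%:R in
  {ae P, forall w,
     (limn_einf (fun t => (F (x t w))%:E) - (F xstar)%:E
        <= (gamma * M * K / (4 * m))%:E)%E} /\
  (2 * m * r * gamma < 1 ->
   forall t,
     ('E_P[fun w => (F (x t w) - F xstar)%R]
        <= ((1 - 2 * m * gamma * r) ^+ t * (F x0 - F xstar)
             + gamma * M * K / (4 * m))%:E)%E).
Proof.
(* [f] is only controlled on [Theta]; its extension by zero is everywhere
   differentiable in the first and measurable in the second variable. *)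
pose g (z : 'rV[R]_(\sum_(b < B) pb b)) (th : 'rV[R]_q) : R :=
  if th \in Theta then f z th else 0.
have gf th : Theta th -> g^~ th = f^~ th.
  by move=> Tth; apply/funext => z; rewrite /g mem_set.
pose T := g_sigma_algebraType (trace_borel Theta).
have mg z : measurable_fun (setT : set T) (g z).
  apply: measurable_trace_borel (hfmeas z) _ => th.
  by rewrite inE => /gf /(congr1 (@^~ z)).
have dg (th : T) z : differentiable (g^~ th) z.
  have [Tth|nTth] := pselect (Theta th); first by rewrite gf //; exact: hfdiff.
  rewrite (_ : g^~ th = cst 0); first exact: differentiable_cst.
  by apply/funext => z'; rewrite /g memNset.
pose D := draws Is xi.
(* The inequality is strict because [x t] is computed from the draws of steps before [t]. The index
   sets of [past t] and [now t] are disjoint, so their independence follows from that of the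
   draws. *)
pose past t := finite_meets D [set j | (draw_time j < t)%N].
pose now t := finite_meets D [set j | draw_time j = t].
have DT := drawsT Is xi; have DI := @setI_closed_draws _ _ _ _ _ _ Is xi.
have mD j : D j `<=` measurable by exact: draws_measurable.
have x_0 w : x 0%N w = x0 by rewrite hx.
have x_S t w : x t.+1 w = x t w - gamma *:
    block_direction tagnat.sig1 g (x t w) (Is t w) (fun i l => xi t i l w).
  rewrite hx rapsaS; congr (_ - _ *: _); apply/rowP => j; rewrite !mxE.
  by case: ifP => // _; congr (_ * _); apply: eq_bigr => l _; rewrite gf.
have past_m t : past t `<=` measurable by exact: finite_meets_measurable.
have now_m t : now t `<=` measurable by exact: finite_meets_measurable.
have past_mono t : past t `<=` past t.+1.
  by apply: finite_meets_subset => j /=; exact: leqW.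
have now_past t : now t `<=` past t.+1.
  by apply: finite_meets_subset => j /= ->.
have past_now t : independent2 P <<s past t >> <<s now t >>.
  apply: independent2_sigma_finite_meets => //.
  by apply/disj_setPS => j /= [jt je]; rewrite je ltnn in jt.
have Is_draw t i : D (inl t) [set w | i \in Is t w].
  by exists [set S : {set 'I_B} | i \in S] => //; rewrite setTI.
have xi_draw t i l (C : set T) : measurable C -> D (inr (t, i, l)) (xi t i l @^-1` C).
  exact: (@sigma_of_preimage _ Theta _ _ (xi t i l) C (hxiTheta t i l)).
have Is_now t i : <<s now t >> [set w | i \in Is t w].
  by apply: sub_sigma_algebra; apply: (@sub_finite_meets _ _ _ D _ (inl t)).
have xi_now t i l (C : set T) : measurable C -> <<s now t >> (xi t i l @^-1` C).
  move=> mC; apply: sub_sigma_algebra.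
  by apply: (@sub_finite_meets _ _ _ D _ (inr (t, i, l))) => //; exact: xi_draw.
have mtheta : measurable_fun (setT : set Omega) (theta : Omega -> T).
  by move=> _ C mC; rewrite setTI; apply: htheta; exact: sigma_of_preimage.
have PIs t i : P [set w | i \in Is t w] = (I%:R / B%:R)%:E.
  exact: measure_sampled.
have xi_law t i l (C : set T) : measurable C ->
    P (theta @^-1` C) = P (xi t i l @^-1` C).
  move=> mC; apply/esym.
  exact: (@same_law_trace_borel _ Theta _ _ _ P (xi t i l) theta C
    (hxiTheta t i l) hTheta (hxilaw t i l) mC).
have xi_Is t i l (C : set T) : measurable C ->
    P ([set w | i \in Is t w] `&` xi t i l @^-1` C) =
    (P [set w | i \in Is t w] * P (xi t i l @^-1` C))%E.
  (* The index list holds one draw of each kind, so the constructor alone selects the event. *)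
  move=> mC; pose E (j : nat + nat * 'I_B * 'I_L) : set Omega :=
    if j is inl _ then [set w | i \in Is t w] else xi t i l @^-1` C.
  have := hindep [:: inl t; inr (t, i, l)] E isT.
  rewrite !big_cons !big_nil setIT mule1; apply => j.
  by rewrite !inE => /orP[] /eqP -> /=; [exact: Is_draw|exact: xi_draw].
have unb z j : 'E_P[fun w => grad (g^~ (theta w)) z 0%R j]%E = (grad F z 0 j)%:E.
  by rewrite -hunbiased; congr expectation; apply/funext => w; rewrite gf.
have mx := x_measurable mg dg x_0 x_S past_m past_mono now_past Is_now xi_now.
have x_theta t A (C : set T) : sigma_of (x t) A -> measurable C ->
    P (A `&` theta @^-1` C) = (P A * P (theta @^-1` C))%E.
  move=> xA mC; rewrite setIC muleC; apply: hfresh xA.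
  exact: (@sigma_of_preimage _ Theta _ _ theta C hTheta mC).
have smom t : {ae P, forall w,
    (\int[P]_w' (enorm (grad (g^~ (theta w')) (x t w)) ^+ 2)%:E <= K%:E)%E}.
  have [Y YE YK] := hK t.
  apply: (second_moment_ae mg dg mtheta (mx t) (@x_theta t) _ YK).
  rewrite (_ : (fun w => _) =
    (fun w => (enorm (grad (f^~ (theta w)) (x t w)) ^+ 2)%:E)) //.
  by apply/funext => w; rewrite gf.
have r0 : 0 < I%:R / B%:R :> R.
  by case/andP: hI => I0 IB; rewrite divr_gt0 ?ltr0n // (leq_trans I0).
move=> r; split.
  have := liminf_gap_le hp hL mg dg hFdiff mtheta x_0 x_S past_m now_m
    past_mono now_past past_now Is_now xi_now PIs xi_law xi_Is unb smom hxstar hlip hm hconvex hgamma r0.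
  apply: filterS => w.
  rewrite (_ : (fun t => (gap F xstar x t w)%:E) =
    (fun t => (- F xstar)%:E + (F (x t w))%:E)%E).
    by rewrite limn_einf_shift // addeC.
  by apply/funext => t; rewrite /gap addrC EFinD.
rewrite mulrAC => rho1 t; rewrite unlock.
rewrite (_ : 2 * m * gamma * r = 2 * m * r * gamma); last by rewrite mulrAC.
apply: (integral_gap_le hp hL mg dg hFdiff mtheta x_0 x_S past_m now_m
    past_mono now_past past_now Is_now xi_now PIs xi_law xi_Is unb smom hxstar hlip hm hconvex hgamma r0).
by rewrite mulrAC.
Qed.
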